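(* For every real $\varepsilon>0$ there exists a constant $C(\varepsilon)>0$, depending only on $\varepsilon$, such that for every positive integer $q$ and every primitive quadratic Dirichlet character $\chi$ modulo $q$, $$L(1,\chi)>C(\varepsilon)\,q^{-\varepsilon}.$$
   Context: A quadratic Dirichlet character is a Dirichlet character of order exactly $2$ (i.e. real-valued and nonprincipal); primitive modulo $q$ means its conductor is $q$. $L(s,\chi)$ is the Dirichlet $L$-function, $L(s,\chi)=\sum_{n\ge1}\chi(n)n^{-s}$ for $\operatorname{Re}(s)>1$, analytically continued; for nonprincipal $\chi$ it is entire, and for quadratic $\chi$ the value $L(1,\chi)$ is real. *)

(* Defs.v *)
(* Stdlib reals with Coquelicot's complex numbers. *)
From Stdlib Require Export Reals ZArith.
From Stdlib Require Import ClassicalEpsilon.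
From Coquelicot Require Export Coquelicot.

Open Scope R_scope.

Definition is_dirichlet_character (q : Z) (chi : Z -> C) : Prop :=
  (forall n : Z, chi (n + q)%Z = chi n) /\
  (forall m n : Z, chi (m * n)%Z = Cmult (chi m) (chi n)) /\
  (forall n : Z, chi n <> RtoC 0 <-> Z.gcd n q = 1%Z).

Definition principal_character (q n : Z) : C :=
  if Z.eq_dec (Z.gcd n q) 1 then RtoC 1 else RtoC 0.

(* [k] is the order of [chi] in the group of characters modulo [q], whose
   identity element is the principal character. *)
Definition has_order (q : Z) (chi : Z -> C) (k : nat) : Prop :=
  (0 < k)%nat /\
  (forall n : Z, Cpow (chi n) k = principal_character q n) /\
  (forall j : nat, (0 < j < k)%nat ->
     ~ (forall n : Z, Cpow (chi n) j = principal_character q n)).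

Definition quadratic (q : Z) (chi : Z -> C) : Prop := has_order q chi 2.

Definition induced_from (q : Z) (chi : Z -> C) (d : Z) : Prop :=
  (0 < d)%Z /\ (d | q)%Z /\
  exists psi : Z -> C, is_dirichlet_character d psi /\
    forall n : Z, Z.gcd n q = 1%Z -> chi n = psi n.

Definition is_conductor (q : Z) (chi : Z -> C) (f : Z) : Prop :=
  induced_from q chi f /\ forall d : Z, induced_from q chi d -> (f <= d)%Z.

Definition primitive (q : Z) (chi : Z -> C) : Prop := is_conductor q chi q.

Definition Cexp (z : C) : C :=
  (exp (Re z) * cos (Im z), exp (Re z) * sin (Im z)).

(* [chi m * m ^ (- s)] for [m = n + 1], so that series start at [m = 1]. *)
Definition dirichlet_term (chi : Z -> C) (s : C) (n : nat) : C :=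
  Cmult (chi (Z.of_nat (S n)))
        (Cexp (Copp (Cmult s (RtoC (ln (INR (S n))))))).

Definition holomorphic_on (U : C -> Prop) (F : C -> C) : Prop :=
  forall z : C, U z -> ex_derive (K := C_AbsRing) (V := C_NormedModule) F z.

Definition path_connected (U : C -> Prop) : Prop :=
  forall a b : C, U a -> U b ->
  exists gamma : R -> C,
    (forall t : R, continuous (U := C_UniformSpace) gamma t) /\
    gamma 0 = a /\ gamma 1 = b /\
    (forall t : R, 0 <= t <= 1 -> U (gamma t)).

(* [v] is the value at [s] of an analytic continuation of the Dirichlet series
   of [chi] from [Re z > 1] to some region containing [s]. *)
Definition is_L_value (chi : Z -> C) (s v : C) : Prop :=
  exists (U : C -> Prop) (F : C -> C),
    open (T := C_UniformSpace) U /\ path_connected U /\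
    (forall z : C, 1 < Re z -> U z) /\ U s /\
    holomorphic_on U F /\
    (forall z : C, 1 < Re z ->
       is_series (K := C_AbsRing) (V := C_NormedModule)
         (dirichlet_term chi z) (F z)) /\
    F s = v.

(* For a Dirichlet character the value is unique whenever it exists, because
   L(s, chi) continues to the whole plane with at most a pole at [s = 1], and
   with no pole if [chi] is nonprincipal; [dirichlet_L chi 1] is a junk value
   if [chi] is principal. *)
Definition dirichlet_L (chi : Z -> C) (s : C) : C :=
  epsilon (inhabits (RtoC 0)) (is_L_value chi s).

(* Main.v *)
(** Estermann's variant of Siegel's argument, with elementary real analysis in place of contour
    integrals.  Write [r] for the Dirichlet convolution of [1], [chi1], [chi2] and [chi1 chi2]; it is
    nonnegative with [r 1 = 1].  Applying the hyperbola method once per character gives, for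
    [0 < e <= 1/16],
      [sum_(n <= x) r(n) n^(e-1) = lam x^e / e + f(1-e) + O(Q^3 x^(-1/32))],
    with [lam = L(1,chi1) L(1,chi2) L(1,chi1 chi2)] and [f] the product of zeta and the three
    L-functions.  The left side is at least 1, so [f(1-e) <= 0] forces [lam >> Q^(-96 e)].  Either
    [L(1-e,chi) >= 0] for all [chi], and then the same estimate for [1 * chi] suffices since
    [zeta(1-e) < 0]; or some [chi1] has a real zero in [(1-e, 1)], at which [f] vanishes for every
    [chi2], and [lam] is compared with the upper bound [L(1,chi1 chi2) << Q^e].

    The continuation of [L(s,chi)] to [Re s > 0] is the series obtained by summation by parts, and
    any other continuation takes the same value at 1 by continuity along real [s > 1]. *)
Require Import Defs.
From Stdlib Require Import Lra Lia Classical ClassicalEpsilon Znumtheory.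
From HB Require Import structures.
From mathcomp Require Import ssreflect ssrfun ssrbool eqtype ssrnat div fintype bigop prime.
From mathcomp Require Import zify.
Set Implicit Arguments.
Unset Strict Implicit.
Unset Printing Implicit Defensive.
Open Scope R_scope.

(** * Dirichlet convolution and the hyperbola identity *)

(** The obstacle is that nothing excludes a real zero of some [L(s,chi)] close to 1. The proof
    exploits such a zero: it removes the secondary term for every other character at once. Whether
    one exists is decided classically, so the constant depends on an unknown zero and an unknown
    modulus and is not effective.

    Origin of the exponents: the error [C Q^3 x^(-1/32)] falls to 1/2 at [x = (2 C Q^3)^32], where
    [x^e] costs [Q^(96 e)]; dividing by the upper bound for [L(1,chi1 chi2)] costs one more [Q^e].
    Hence the choice of [e] at most [eps/97].

    The analysis sees a character only through multiplicativity, its values, and a bound [Q] for its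
    sums over intervals. The product of two characters, possibly imprimitive, is thus treated like
    its factors, with the product of the moduli as bound. Primitivity makes the product of two
    different characters nonprincipal.

    Nonnegativity of [r] comes from a formula for [v_p(n) r(n)], whose coefficients are those of a
    logarithmic derivative; there the four factors add up to [(1 + chi1)(1 + chi2)] and the sign is
    visible. *)

HB.instance Definition _ := Monoid.isComLaw.Build R 0 Rplus
  (fun x y z => Logic.eq_sym (Rplus_assoc x y z)) Rplus_comm Rplus_0_l.
HB.instance Definition _ := Monoid.isMulLaw.Build R 0 Rmult Rmult_0_l Rmult_0_r.
HB.instance Definition _ := Monoid.isAddLaw.Build R Rmult Rplus
  Rmult_plus_distr_r Rmult_plus_distr_l.

Notation "\sum_ ( m <= i < n | P ) F" := (\big[Rplus/0]_(m <= i < n | P%B) F) : R_scope.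
Notation "\sum_ ( m <= i < n ) F" := (\big[Rplus/0]_(m <= i < n) F) : R_scope.

Lemma sum_le m n (P : pred nat) (F G : nat -> R) :
  (forall i, (m <= i < n)%N -> P i -> F i <= G i) ->
  \sum_(m <= i < n | P i) F i <= \sum_(m <= i < n | P i) G i.
Proof.
move=> h; rewrite big_nat_cond [X in _ <= X]big_nat_cond.
elim/big_rec2: _ => [|i y1 y2 /andP[hi Pi] hy]; first lra.
by have := h i hi Pi; lra.
Qed.

Lemma sum_ge0 m n (P : pred nat) (F : nat -> R) :
  (forall i, (m <= i < n)%N -> P i -> 0 <= F i) -> 0 <= \sum_(m <= i < n | P i) F i.
Proof.
move=> h; rewrite big_nat_cond; elim/big_rec: _ => [|i y /andP[hi Pi] hy]; first lra.
by have := h i hi Pi; lra.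
Qed.

Lemma sum_abs m n (P : pred nat) (F : nat -> R) :
  Rabs (\sum_(m <= i < n | P i) F i) <= \sum_(m <= i < n | P i) Rabs (F i).
Proof.
elim/big_rec2: _ => [|i y1 y2 _ hy]; first by rewrite Rabs_R0; lra.
by have := Rabs_triang (F i) y2; lra.
Qed.

Lemma sum_distrr m n (P : pred nat) (c : R) (F : nat -> R) :
  c * \sum_(m <= i < n | P i) F i = \sum_(m <= i < n | P i) (c * F i).
Proof. exact: big_distrr. Qed.

Lemma sum_distrl m n (P : pred nat) (c : R) (F : nat -> R) :
  (\sum_(m <= i < n | P i) F i) * c = \sum_(m <= i < n | P i) (F i * c).
Proof. exact: big_distrl. Qed.

Lemma sum_split m n (P : pred nat) (F G : nat -> R) :
  \sum_(m <= i < n | P i) (F i + G i) =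
  \sum_(m <= i < n | P i) F i + \sum_(m <= i < n | P i) G i.
Proof. exact: big_split. Qed.

Lemma sum_opp m n (P : pred nat) (F : nat -> R) :
  \sum_(m <= i < n | P i) (- F i) = - \sum_(m <= i < n | P i) F i.
Proof.
have -> : - \sum_(m <= i < n | P i) F i = -1 * \sum_(m <= i < n | P i) F i by ring.
by rewrite sum_distrr; apply: eq_bigr => i _; ring.
Qed.

Lemma sum_sub m n (P : pred nat) (F G : nat -> R) :
  \sum_(m <= i < n | P i) (F i - G i) =
  \sum_(m <= i < n | P i) F i - \sum_(m <= i < n | P i) G i.
Proof. by rewrite /Rminus -sum_opp -sum_split. Qed.

Lemma sum_const m n (c : R) : (m <= n)%N -> \sum_(m <= i < n) c = INR (n - m) * c.
Proof.
move=> /subnK <-; elim: (n - m)%N => [|k IH].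
  by rewrite add0n subnn big_geq //=; lra.
rewrite addSn big_nat_recr ?leq_addl //= IH subSn ?leq_addl // S_INR.
lra.
Qed.

Lemma sum_recr (F : nat -> R) m n : (m <= n)%N ->
  \sum_(m <= i < n.+1) F i = \sum_(m <= i < n) F i + F n.
Proof. by move=> h; rewrite big_nat_recr. Qed.

Lemma sum_cat (F : nat -> R) m n p : (m <= n)%N -> (n <= p)%N ->
  \sum_(m <= i < p) F i = \sum_(m <= i < n) F i + \sum_(n <= i < p) F i.
Proof. by move=> h1 h2; rewrite (big_cat_nat h1 h2). Qed.

Lemma sum0 (F : nat -> R) m n : (forall i, (m <= i < n)%N -> F i = 0) ->
  \sum_(m <= i < n) F i = 0.
Proof. by move=> h; rewrite big_nat big1. Qed.

Lemma divn_dvd_gt0 d n : (0 < n)%N -> (d %| n)%N -> (0 < n %/ d)%N.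
Proof. by move=> n0 dn; rewrite divn_gt0 ?(dvdn_gt0 n0 dn) // (dvdn_leq n0 dn). Qed.

Lemma sum_multiples (F : nat -> R) d N : (0 < d)%N ->
  \sum_(1 <= n < N.+1 | (d %| n)%N) F n = \sum_(1 <= e < (N %/ d).+1) F (d * e)%N.
Proof.
move=> d0; elim: N => [|N IH]; first by rewrite div0n !big_geq.
rewrite big_mkcond /= sum_recr // -big_mkcond /= IH divnS //.
case: ifP => h /=; last by rewrite add0n; lra.
rewrite add1n [RHS]sum_recr //; congr (_ + _); congr F.
by rewrite mulnC; have := divnK h; rewrite divnS // h add1n.
Qed.

Definition dconv (a b : nat -> R) (n : nat) : R :=
  \sum_(1 <= d < n.+1 | (d %| n)%N) (a d * b (n %/ d)%N).

Lemma dconv1 a b : dconv a b 1 = a 1%N * b 1%N.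
Proof. by rewrite /dconv big_mkcond big_nat1 /=. Qed.

Lemma dconv_widen a b n N : (0 < n)%N -> (n <= N)%N ->
  dconv a b n = \sum_(1 <= d < N.+1 | (d %| n)%N) (a d * b (n %/ d)%N).
Proof.
move=> n0 nN; rewrite [RHS]big_mkcond (@sum_cat _ 1 n.+1) // -big_mkcond /=.
rewrite [X in _ = _ + X]sum0 ?Rplus_0_r // => d /andP[h _].
by case: ifP => // /(dvdn_leq n0); lia.
Qed.

Lemma dconv_mul (w a b : nat -> R) n :
  (forall i j, (0 < i)%N -> (0 < j)%N -> w (i * j)%N = w i * w j) -> (0 < n)%N ->
  dconv (fun k => w k * a k) (fun k => w k * b k) n = w n * dconv a b n.
Proof.
move=> wM n0; rewrite /dconv sum_distrr big_nat_cond [RHS]big_nat_cond.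
apply: eq_bigr => d /andP[/andP[d0 _] dn].
have h : (0 < n %/ d)%N by exact: divn_dvd_gt0.
have -> : w n = w d * w (n %/ d)%N by rewrite -wM // mulnC divnK.
ring.
Qed.

Lemma sum_dconv a b N :
  \sum_(1 <= n < N.+1) dconv a b n =
  \sum_(1 <= m < N.+1) (a m * \sum_(1 <= n < (N %/ m).+1) b n).
Proof.
transitivity (\sum_(1 <= n < N.+1) \sum_(1 <= m < N.+1 | (m %| n)%N) (a m * b (n %/ m)%N)).
  apply: eq_big_nat => n /andP[h1 h2]; exact: dconv_widen.
transitivity (\sum_(1 <= m < N.+1) \sum_(1 <= n < N.+1 | (m %| n)%N) (a m * b (n %/ m)%N)).
  rewrite (eq_bigr (fun n => \sum_(1 <= m < N.+1)
     (if (m %| n)%N then a m * b (n %/ m)%N else 0))); last by move=> n _; rewrite big_mkcond.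
  by rewrite exchange_big /=; apply: eq_bigr => m _; rewrite -big_mkcond.
apply: eq_big_nat => m /andP[m0 _].
rewrite sum_distrr sum_multiples //; apply: eq_bigr => n _.
by rewrite mulKn.
Qed.

(** The hypotheses say that [Y] is the integer square root of [N]. Pairs with [n <= Y] form the
    first sum; the others have [n > Y], hence [m <= Y]. In the second sum [b] occurs only through
    differences of partial sums, which are small when [b] oscillates. *)
Lemma dconv_hyperbola a b N Y : (Y * Y <= N)%N -> (N < Y.+1 * Y.+1)%N ->
  \sum_(1 <= n < N.+1) dconv a b n =
  \sum_(1 <= n < Y.+1) (b n * \sum_(1 <= m < (N %/ n).+1) a m) +
  \sum_(1 <= m < Y.+1)
    (a m * (\sum_(1 <= n < (N %/ m).+1) b n - \sum_(1 <= n < Y.+1) b n)).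
Proof.
move=> YN NY; have YN' : (Y <= N)%N by nia.
rewrite sum_dconv (@sum_cat _ 1 Y.+1) //.
(* Here [m > Y] forces [n <= Y], because [N < (Y+1)^2]; the order of summation is then exchanged. *)
have -> : \sum_(Y.+1 <= m < N.+1) (a m * \sum_(1 <= n < (N %/ m).+1) b n) =
  \sum_(1 <= n < Y.+1) (b n * (\sum_(1 <= m < (N %/ n).+1) a m - \sum_(1 <= m < Y.+1) a m)).
  transitivity (\sum_(Y.+1 <= m < N.+1) \sum_(1 <= n < Y.+1) if (n * m <= N)%N then a m * b n else 0).
    apply: eq_big_nat => m /andP[Ym mN]; rewrite sum_distrr.
    have h : (N %/ m <= Y)%N by rewrite -ltnS ltn_divLR; nia.
    rewrite [RHS](@sum_cat _ 1 (N %/ m).+1) //.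
    rewrite [X in _ = _ + X]sum0 ?Rplus_0_r; last first.
      move=> n /andP[nN nY]; case: ifP => // hh; suff: (n <= N %/ m)%N by lia.
      by rewrite leq_divRL; lia.
    apply: eq_big_nat => n /andP[n0 nN]; rewrite ltnS leq_divRL in nN; last by lia.
    by rewrite nN.
  rewrite exchange_big /=; apply: eq_big_nat => n /andP[n0 nY].
  have h : (Y <= N %/ n)%N by rewrite leq_divRL //; nia.
  rewrite (@sum_cat _ 1 Y.+1 (N %/ n).+1) //.
  have -> : forall u v : R, u + v - u = v by move=> *; ring.
  have hN : (N %/ n <= N)%N by exact: leq_div.
  rewrite (@sum_cat _ Y.+1 (N %/ n).+1) //.
  rewrite [X in _ + X = _]sum0 ?Rplus_0_r; last first.
    move=> m /andP[hm _]; case: ifP => // hh; suff: (m <= N %/ n)%N by lia.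
    by rewrite leq_divRL // mulnC.
  rewrite sum_distrr; apply: eq_big_nat => m /andP[hm1 hm2].
  rewrite ltnS leq_divRL // mulnC in hm2; rewrite hm2; ring.
under [X in _ + X = _]eq_bigr do rewrite Rmult_minus_distr_l.
under [X in _ = _ + X]eq_bigr do rewrite Rmult_minus_distr_l.
rewrite !sum_sub -!sum_distrl; ring.
Qed.

(* [p]-adic logarithmic derivative: [v_p * f] is the convolution of [f] with [h] on powers of [p]. *)
Definition logder (p : nat) (f h : nat -> R) : Prop :=
  forall n, (0 < n)%N ->
  INR (logn p n) * f n = \sum_(1 <= k < (logn p n).+1) (h (p ^ k)%N * f (n %/ p ^ k)%N).

Lemma logder_widen p f h n K : prime p -> logder p f h -> (0 < n)%N -> (logn p n <= K)%N ->
  INR (logn p n) * f n =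
  \sum_(1 <= k < K.+1 | (p ^ k %| n)%N) (h (p ^ k)%N * f (n %/ p ^ k)%N).
Proof.
move=> pp hf n0 hK; rewrite hf // [RHS]big_mkcond (@sum_cat _ 1 (logn p n).+1 K.+1) //=.
rewrite [X in _ = _ + X]sum0 ?Rplus_0_r.
  by apply: eq_big_nat => k /andP[_ hk]; rewrite pfactor_dvdn // -ltnS hk.
by move=> k /andP[hk _]; rewrite pfactor_dvdn // leqNgt hk.
Qed.

(** Complete multiplicativity makes each of the [logn p n] summands equal to [c n]. *)
Lemma logder_mul (c : nat -> R) p : prime p ->
  (forall i j, (0 < i)%N -> (0 < j)%N -> c (i * j)%N = c i * c j) -> logder p c c.
Proof.
move=> pp cM n n0.
transitivity (\sum_(1 <= k < (logn p n).+1) c n).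
  by rewrite sum_const // subSS subn0.
apply: eq_big_nat => k /andP[k1 k2].
have hd : (p ^ k %| n)%N by rewrite pfactor_dvdn // -ltnS.
have pk0 : (0 < p ^ k)%N by rewrite expn_gt0 prime_gt0.
by rewrite -cM ?divn_dvd_gt0 // mulnC divnK.
Qed.

(** Since [logn p] is additive, multiplication by it is a derivation for Dirichlet convolution. Each
    term of the product rule is then reassociated. *)
Lemma logder_dconv p a b ha hb : prime p -> logder p a ha -> logder p b hb ->
  logder p (dconv a b) (fun n => ha n + hb n).
Proof.
move=> pp Ha Hb n n0; set K := logn p n.
have pk0 k : (0 < p ^ k)%N by rewrite expn_gt0 prime_gt0.
have lK d : (d %| n)%N -> (logn p d <= K)%N by move=> h; apply: dvdn_leq_log.
under [RHS]eq_bigr do rewrite Rmult_plus_distr_r.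
rewrite sum_split.
transitivity
  (\sum_(1 <= d < n.+1 | (d %| n)%N) (INR (logn p d) * a d * b (n %/ d)%N) +
   \sum_(1 <= d < n.+1 | (d %| n)%N) (a d * (INR (logn p (n %/ d)) * b (n %/ d)%N))).
  rewrite /dconv sum_distrr -sum_split big_nat_cond [RHS]big_nat_cond.
  apply: eq_bigr => d /andP[/andP[d0 _] dn].
  have -> : INR K = INR (logn p d) + INR (logn p (n %/ d)).
    rewrite -plus_INR; congr INR; rewrite plusE -lognM ?divn_dvd_gt0 //.
    by rewrite mulnC divnK.
  ring.
congr (_ + _).
- transitivity (\sum_(1 <= d < n.+1 | (d %| n)%N) \sum_(1 <= k < K.+1)
     if (p ^ k %| d)%N then ha (p ^ k)%N * (a (d %/ p ^ k)%N * b (n %/ d)%N) else 0).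
    rewrite big_nat_cond [RHS]big_nat_cond.
    apply: eq_bigr => d /andP[/andP[d0 _] dn].
    rewrite (logder_widen pp Ha d0 (lK _ dn)) sum_distrl -big_mkcond /=.
    by apply: eq_bigr => k _; ring.
  rewrite exchange_big /=; apply: eq_big_nat => k /andP[k1 k2].
  have hk : (p ^ k %| n)%N by rewrite pfactor_dvdn // -ltnS.
  rewrite -big_mkcondr.
  under eq_bigl do rewrite andbC.
  rewrite big_mkcondr sum_multiples // -big_mkcond /= /dconv sum_distrr.
  apply: eq_big => [e|e _]; first by rewrite dvdn_divRL // mulnC.
  by rewrite mulKn // divnMA.
- transitivity (\sum_(1 <= d < n.+1 | (d %| n)%N) \sum_(1 <= k < K.+1)
     if (p ^ k %| n %/ d)%N then hb (p ^ k)%N * (a d * b (n %/ d %/ p ^ k)%N) else 0).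
    rewrite big_nat_cond [RHS]big_nat_cond.
    apply: eq_bigr => d /andP[/andP[d0 _] dn].
    have hn : (n %/ d %| n)%N by apply/dvdnP; exists d; rewrite mulnC divnK.
    have hn0 : (0 < n %/ d)%N by exact: divn_dvd_gt0.
    rewrite (logder_widen pp Hb hn0 (lK _ hn)) sum_distrr -big_mkcond /=.
    by apply: eq_bigr => k _; ring.
  rewrite exchange_big /=; apply: eq_big_nat => k /andP[k1 k2].
  have hk : (p ^ k %| n)%N by rewrite pfactor_dvdn // -ltnS.
  have hk0 : (0 < n %/ p ^ k)%N by exact: divn_dvd_gt0.
  rewrite -big_mkcondr (@dconv_widen _ _ _ n) ?leq_div // sum_distrr.
  rewrite big_nat_cond [RHS]big_nat_cond; apply: eq_big => [d|d _].
    case: (_ <= d < _)%N / andP => // -[d0 _] /=.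
    apply/andP/idP => [[h1 h2]|h].
      by move: h2; rewrite !dvdn_divRL // mulnC.
    rewrite dvdn_divRL // in h.
    have h1 : (d %| n)%N by apply: dvdn_trans h; apply: dvdn_mulr.
    by rewrite h1 dvdn_divRL // mulnC.
  by rewrite -!divnMA mulnC.
Qed.

(** For a prime [p] dividing [n], the positive multiple [logn p n] of [f n] is a combination of
    values of [f] at smaller arguments with coefficients from [h], so strong induction applies. *)
Lemma logder_ge0 f h : (forall p, prime p -> logder p f h) -> 0 <= f 1%N ->
  (forall n, (0 < n)%N -> 0 <= h n) -> forall n, (0 < n)%N -> 0 <= f n.
Proof.
move=> hf f1 h0 n; elim/ltn_ind: n => n IH n0.
case: (ltnP 1 n) => n1; last by have -> : n = 1%N by lia.
have pp := pdiv_prime n1; set p := pdiv n in pp.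
have pn : (p %| n)%N by apply: pdiv_dvd.
have l0 : (0 < logn p n)%N by rewrite logn_gt0 mem_primes pp n0.
have l0' : 0 < INR (logn p n) by apply: lt_0_INR; lia.
suff : 0 <= INR (logn p n) * f n by nra.
rewrite (hf _ pp n n0); apply: sum_ge0 => k /andP[k1 k2] _.
have hk : (p ^ k %| n)%N by rewrite pfactor_dvdn // -ltnS.
have pk1 : (1 < p ^ k)%N by rewrite -(expn0 p) ltn_exp2l // prime_gt1.
apply: Rmult_le_pos; first by apply: h0; lia.
by apply: IH; [apply: ltn_Pdiv | apply: divn_dvd_gt0].
Qed.

(** This evaluates the minorant used below: when the exponent of [p] is even, the even [k] alone,
    with weight 2, already make up the whole exponent. *)
Lemma sum_even_two w : \sum_(1 <= k < (w.*2).+1) (if odd k then 0 else 2) = INR w.*2.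
Proof.
elim: w => [|w IH]; first by rewrite big_geq.
rewrite doubleS !S_INR 2?sum_recr // IH /= odd_double /=; ring.
Qed.

(* Stated for more than squares, so that the induction can divide out powers of a prime. *)
Lemma dconv_char_ge1 (x : nat -> R) :
  (forall i j, (0 < i)%N -> (0 < j)%N -> x (i * j)%N = x i * x j) -> x 1%N = 1 ->
  (forall n, x n = -1 \/ x n = 0 \/ x n = 1) ->
  forall n, (0 < n)%N ->
  (forall p, prime p -> odd (logn p n) -> x p = 0) ->
  1 <= dconv (fun=> 1) x n.
Proof.
move=> xM x1 xv.
have hd p : prime p -> logder p (dconv (fun=> 1) x) (fun n => 1 + x n).
  move=> pp; apply: logder_dconv => //; apply: logder_mul => //= *; lra.
have h0 : forall n, (0 < n)%N -> 0 <= dconv (fun=> 1) x n.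
  apply: (logder_ge0 hd); first by rewrite dconv1 x1; lra.
  by move=> n _; case: (xv n) => [->|[->|->]]; lra.
have xX p k : (0 < p)%N -> x (p ^ k)%N = x p ^ k.
  by move=> p0; elim: k => [|k IH]; rewrite ?expn0 // expnS xM ?expn_gt0 ?p0 // IH.
move=> n; elim/ltn_ind: n => n IH n0 hn.
case: (ltnP 1 n) => n1; last first.
  by (have -> : n = 1%N by lia); rewrite dconv1 x1; lra.
have pp := pdiv_prime n1; set p := pdiv n in pp.
have pn : (p %| n)%N by apply: pdiv_dvd.
have l0 : (0 < logn p n)%N by rewrite logn_gt0 mem_primes pp n0.
have l0' : 0 < INR (logn p n) by apply: lt_0_INR; lia.
have p0 : (0 < p)%N by apply: prime_gt0.
suff : INR (logn p n) <= INR (logn p n) * dconv (fun=> 1) x n by nra.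
rewrite (hd _ pp n n0).
have nk k : (0 < k)%N -> (k <= logn p n)%N ->
  [/\ (n %/ p ^ k < n)%N, (0 < n %/ p ^ k)%N &
    forall l, prime l -> logn l (n %/ p ^ k) = (logn l n - (if l == p then k else 0))%N].
  move=> k1 k2; have hk : (p ^ k %| n)%N by rewrite pfactor_dvdn.
  have pk1 : (1 < p ^ k)%N by rewrite -(expn0 p) ltn_exp2l // prime_gt1.
  split; [exact: ltn_Pdiv | exact: divn_dvd_gt0 |].
  move=> l pl; rewrite logn_div // lognX (logn_prime l pp).
  by case: (l == p); rewrite ?muln1 ?muln0.
(* If [x p = 0], the exponent of [p] is unrestricted, so any power of [p] may be divided out, and
   every [k] contributes at least 1. *)
case: (Req_dec (x p) 0) => [xp|xp].
  apply: (Rle_trans _ (\sum_(1 <= k < (logn p n).+1) 1)).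
    by rewrite sum_const // subSS subn0; lra.
  apply: sum_le => k /andP[k1 k2] _; case: (nk k k1 k2) => h1 h2 h3.
  rewrite xX // xp pow_i; last by lia.
  suff : 1 <= dconv (fun=> 1) x (n %/ p ^ k) by lra.
  apply: IH => // l pl; rewrite h3 //; case: eqP => [-> //|_].
  by rewrite subn0; apply: hn.
have ev : ~~ odd (logn p n) by apply/negP => /(hn _ pp).
have evE : logn p n = ((logn p n)./2).*2 by rewrite even_halfK.
(* If [x p] is nonzero, only an even [k] keeps the exponent of [p] even. There the coefficient
   [1 + x (p^k)] is 2; for odd [k] nonnegativity suffices. *)
apply: (Rle_trans _ (\sum_(1 <= k < (logn p n).+1) (if odd k then 0 else 2))).
  by rewrite evE sum_even_two; lra.
apply: sum_le => k /andP[k1 k2] _; case: (nk k k1 k2) => h1 h2 h3.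
have hx : -1 <= x (p ^ k)%N by case: (xv (p ^ k)%N) => [->|[->|->]]; lra.
case: ifP => ok; first by apply: Rmult_le_pos; [lra | apply: h0].
have -> : x (p ^ k)%N = 1.
  rewrite xX // -(even_halfK (negbT ok)) -addnn; rewrite -plusE pow_add.
  by rewrite -Rpow_mult_distr (_ : x p * x p = 1) ?pow1 //; case: (xv p) => [->|[|->]] //; lra.
suff : 1 <= dconv (fun=> 1) x (n %/ p ^ k) by lra.
apply: IH => // l pl; rewrite h3 //; case: eqP => [->|_]; last by rewrite subn0; apply: hn.
by rewrite oddB // (negbTE ev) ok.
Qed.

(** * Partial sums of zeta and of L-functions at real points *)

Lemma Rabs_sub_le a b : Rabs (a - b) <= Rabs a + Rabs b.
Proof. by rewrite -(Rabs_Ropp b); apply: Rabs_triang. Qed.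

Definition natfloor (x : R) : nat := Z.to_nat (Int_part x).

Lemma natfloorP x : 0 <= x -> INR (natfloor x) <= x < INR (natfloor x) + 1.
Proof.
move=> x0; have [h1 h2] := base_Int_part x.
have h : (0 <= Int_part x)%Z.
  have : IZR (-1) < IZR (Int_part x) by lra.
  by move/lt_IZR; lia.
rewrite /natfloor INR_IZR_INZ Z2Nat.id //; lra.
Qed.

Lemma leq_natfloor x n : 0 <= x -> (n <= natfloor x)%N <-> INR n <= x.
Proof.
move=> /natfloorP[h1 h2]; split=> h.
  by have : INR n <= INR (natfloor x) by [apply: le_INR; lia]; lra.
rewrite leqNgt; apply/negP => h3.
have : INR (natfloor x).+1 <= INR n by apply: le_INR; lia.
rewrite S_INR; lra.
Qed.

Lemma natfloor_INR n : natfloor (INR n) = n.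
Proof.
have h := pos_INR n; apply/eqP; rewrite eqn_leq; apply/andP; split.
  by have [h1 _] := natfloorP h; move/INR_le: h1; lia.
by apply/leq_natfloor => //; lra.
Qed.

Lemma INR_gt0 n : (0 < n)%N -> 0 < INR n.
Proof. by move=> h; apply: lt_0_INR; lia. Qed.

Lemma INR_ge1 n : (0 < n)%N -> 1 <= INR n.
Proof. by move=> h; have := le_INR 1 n; rewrite /=; apply; lia. Qed.

Lemma natfloor_div x m : 0 <= x -> (0 < m)%N -> natfloor (x / INR m) = (natfloor x %/ m)%N.
Proof.
move=> x0 m0; have hm := INR_gt0 m0.
have hx : 0 <= x / INR m by apply: Rdiv_le_0_compat.
have key k : (k <= natfloor (x / INR m))%N <-> (k <= natfloor x %/ m)%N.
  rewrite leq_divRL // !leq_natfloor // -multE mult_INR.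
  split=> h; first by apply: (Rmult_le_reg_r (/ INR m)); [apply: Rinv_0_lt_compat | field_simplify; lra].
  by apply: (Rmult_le_reg_r (INR m)) => //; field_simplify; lra.
by apply/eqP; rewrite eqn_leq; apply/andP; split; apply/key.
Qed.

Lemma natfloor_ge1 x : 1 <= x -> (0 < natfloor x)%N.
Proof. by move=> h; apply/leq_natfloor; rewrite /=; lra. Qed.

Definition psum (a : nat -> R) (x : R) : R := \sum_(1 <= n < (natfloor x).+1) a n.

Lemma psum_hyperbola a b x : 1 <= x ->
  psum (dconv a b) x =
  \sum_(1 <= n < (natfloor (sqrt x)).+1) (b n * psum a (x / INR n)) +
  \sum_(1 <= m < (natfloor (sqrt x)).+1) (a m * (psum b (x / INR m) - psum b (sqrt x))).
Proof.
move=> x1; rewrite /psum.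
have s0 := sqrt_pos x; have sx : sqrt x * sqrt x = x by apply: sqrt_sqrt; lra.
have [h1 h2] := natfloorP s0; have hn := pos_INR (natfloor (sqrt x)).
rewrite (@dconv_hyperbola _ _ _ (natfloor (sqrt x))).
- congr (_ + _); apply: eq_big_nat => n /andP[n0 _]; rewrite natfloor_div //; lra.
- apply/leq_natfloor; first lra.
  rewrite -multE mult_INR; nra.
- rewrite ltnNge; apply/negP => /leq_natfloor; rewrite -multE mult_INR S_INR => h.
  by have : x < x by [apply: Rlt_le_trans (h _); nra]; lra.
Qed.

(** * Real powers and comparison of their sums with integrals *)

Lemma Rpower_pos x s : 0 < Rpower x s. Proof. exact: exp_pos. Qed.

Lemma Rpower1_base s : Rpower 1 s = 1.
Proof. by rewrite /Rpower ln_1 Rmult_0_r exp_0. Qed.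

Lemma Rpower_ge1 x s : 1 <= x -> 0 <= s -> 1 <= Rpower x s.
Proof. by move=> h1 h2; rewrite -(Rpower_O x); [apply: Rle_Rpower | lra]. Qed.

Lemma Rpower_le_neg a x y : 0 <= a -> 0 < x -> x <= y -> Rpower y (- a) <= Rpower x (- a).
Proof.
move=> a0 x0 xy; rewrite !Rpower_Ropp; apply: Rinv_le_contravar; first exact: Rpower_pos.
by apply: Rle_Rpower_l.
Qed.

Lemma Rpower_div x y s : 0 < x -> 0 < y -> Rpower (x / y) s = Rpower x s * Rpower y (- s).
Proof.
move=> x0 y0; rewrite /Rdiv -Rpower_mult_distr //; last exact: Rinv_0_lt_compat.
by congr (_ * _); rewrite /Rpower ln_Rinv //; congr exp; ring.
Qed.

Lemma Rpower_sqrt_base x s : 0 < x -> Rpower (sqrt x) s = Rpower x (s / 2).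
Proof.
move=> x0; rewrite -Rpower_sqrt // Rpower_mult; congr Rpower; field.
Qed.

Lemma Rpower_small s e : 0 < s -> 0 < e ->
  exists X, 1 <= X /\ forall x, X <= x -> Rpower x (- s) < e.
Proof.
move=> s0 e0; exists (Rpower e (- / s) + 1); split.
  by have := Rpower_pos e (- / s); lra.
move=> x hx; have hp := Rpower_pos e (- / s).
rewrite Rpower_Ropp -(Rinv_inv e); apply: Rinv_lt_contravar.
  by apply: Rmult_lt_0_compat; [apply: Rinv_0_lt_compat | apply: Rpower_pos].
have -> : / e = Rpower (Rpower e (- / s)) s.
  rewrite Rpower_mult (_ : - / s * s = - 1); last by field; lra.
  by rewrite Rpower_Ropp Rpower_1.
apply: Rlt_Rpower_l => //; lra.
Qed.

Lemma Rpower_mvt s u v : 0 < u -> u < v ->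
  exists t, u < t < v /\ Rpower v s - Rpower u s = s * Rpower t (s - 1) * (v - u).
Proof.
move=> u0 uv.
have [|t [h1 h2]] := @MVT_cor2 (fun x => Rpower x s) (fun x => s * Rpower x (s - 1)) u v uv.
  by move=> c hc; apply: derivable_pt_lim_power; lra.
by exists t; split => //; rewrite h1; ring.
Qed.

(** Mean value theorem for [x^e / e], whose derivative [x^(e-1)] is nonincreasing. *)
Lemma Rpower_incr_bounds e u v : 0 < e -> e <= 1 -> 0 < u -> u <= v ->
  (v - u) * Rpower v (- (1 - e)) <= Rpower v e / e - Rpower u e / e
    <= (v - u) * Rpower u (- (1 - e)).
Proof.
move=> e0 e1 u0 uv; case: (Rle_lt_or_eq_dec _ _ uv) => [{}uv|<-]; last by lra.
have [t [ht h]] := Rpower_mvt e u0 uv.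
have -> : Rpower v e / e - Rpower u e / e = (v - u) * Rpower t (- (1 - e)).
  have -> : Rpower v e / e - Rpower u e / e = (Rpower v e - Rpower u e) / e by field; lra.
  rewrite h (_ : e - 1 = - (1 - e)); last by ring.
  by field; lra.
by split; apply: Rmult_le_compat_l; try apply: Rpower_le_neg; lra.
Qed.

Lemma sum_Rpower_conv N s : 0 < s ->
  \sum_(1 <= n < N.+1) Rpower (INR n) (- 1 - s) <= 1 + / s.
Proof.
move=> s0; case: N => [|N].
  by rewrite big_geq //; have := Rinv_0_lt_compat _ s0; lra.
(* The induction needs the subtracted tail: its decrease from one index to the next pays for the new
   term. *)
suff : \sum_(1 <= n < N.+2) Rpower (INR n) (- 1 - s) <= 1 + / s - / s * Rpower (INR N.+1) (- s).
  have := Rpower_pos (INR N.+1) (- s); have := Rinv_0_lt_compat _ s0; nra.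
elim: N => [|N IH].
  by rewrite big_nat1 /= !Rpower1_base; lra.
rewrite sum_recr //; set a := INR N.+1 in IH *.
have a0 : 0 < a by apply: INR_gt0.
have -> : INR N.+2 = a + 1 by rewrite S_INR.
have [|t [ht h]] := @Rpower_mvt (- s) a (a + 1) a0; first lra.
have h2 : Rpower (a + 1) (- 1 - s) <= Rpower t (- 1 - s).
  rewrite (_ : -1 - s = - (1 + s)); last by ring.
  by apply: Rpower_le_neg; lra.
have h3 : / s * Rpower (a + 1) (- s) = / s * Rpower a (- s) - Rpower t (- 1 - s).
  have -> : Rpower (a + 1) (- s) = Rpower a (- s) + - s * Rpower t (- s - 1) * (a + 1 - a) by lra.
  rewrite (_ : - s - 1 = -1 - s); last by ring.
  by field; lra.
lra.
Qed.

(* [wt s 0 = 1], because [ln 0 = 0]: all sums start at 1. *)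
Definition wt (s : R) (n : nat) : R := Rpower (INR n) (- s).

Lemma wt_pos s n : 0 < wt s n. Proof. exact: Rpower_pos. Qed.

Lemma wtM s i j : (0 < i)%N -> (0 < j)%N -> wt s (i * j)%N = wt s i * wt s j.
Proof. by move=> i0 j0; rewrite /wt -multE mult_INR Rpower_mult_distr //; apply: INR_gt0. Qed.

Lemma wt1 s : wt s 1 = 1. Proof. exact: Rpower1_base. Qed.

Lemma wt_le s i j : 0 <= s -> (0 < i)%N -> (i <= j)%N -> wt s j <= wt s i.
Proof.
move=> s0 i0 ij; apply: Rpower_le_neg => //; first exact: INR_gt0.
by apply: le_INR; lia.
Qed.

(** [z] is zeta(1-e). The difference [D N] of sum and integral is nonincreasing, while [D N] minus
    its last summand is nondecreasing; [z] is the supremum of the latter. Comparison with [D 1]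
    gives the upper bound for [z], which later supplies the sign of zeta(1-e). *)
Lemma wt_sum_bracket e : 0 < e -> e <= 1 -> exists z, z <= 1 - / e /\ forall N, (0 < N)%N ->
  z <= \sum_(1 <= n < N.+1) wt (1 - e) n - Rpower (INR N) e / e <= z + wt (1 - e) N.
Proof.
move=> e0 e1; set D := fun N => \sum_(1 <= n < N.+1) wt (1 - e) n - Rpower (INR N) e / e.
have step N : (0 < N)%N -> D N.+1 <= D N /\ D N - wt (1 - e) N <= D N.+1 - wt (1 - e) N.+1.
  move=> N0; rewrite /D sum_recr // /wt.
  have hN := INR_gt0 N0; have -> : INR N.+1 = INR N + 1 by rewrite S_INR.
  have [||h1 h2] := Rpower_incr_bounds (u := INR N) (v := INR N + 1) e0 e1; first lra.
    lra.
  lra.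
have D1 : D 1%N = 1 - / e by rewrite /D big_nat1 wt1 /= Rpower1_base; lra.
have mono k N : (0 < N)%N -> D (N + k)%N <= D N /\ D N - wt (1 - e) N <= D (N + k)%N - wt (1 - e) (N + k)%N.
  move=> N0; elim: k => [|k [IH1 IH2]]; first by rewrite addn0; lra.
  have [|h1 h2] := step (N + k)%N; first by lia.
  rewrite addnS; lra.
have cross M N : (0 < M)%N -> (0 < N)%N -> D M - wt (1 - e) M <= D N.
  move=> M0 N0; case: (leqP M N) => h.
    have [_ h2] := mono (N - M)%N M M0; rewrite subnKC // in h2.
    by have := wt_pos (1 - e) N; lra.
  have [h2 _] := mono (M - N)%N N N0; rewrite subnKC in h2; last by lia.
  by have := wt_pos (1 - e) M; lra.
pose E := fun y => exists2 M, (0 < M)%N & y = D M - wt (1 - e) M.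
have [||z [z1 z2]] := completeness E.
- by exists (D 1%N) => y [M M0 ->]; apply: cross.
- by exists (D 1%N - wt (1 - e) 1); exists 1%N.
exists z; split.
  by rewrite -D1; apply: z2 => y [M M0 ->]; apply: cross.
move=> N N0; split.
  by apply: z2 => y [M M0 ->]; apply: cross.
suff : D N - wt (1 - e) N <= z by rewrite /D; lra.
by apply: z1; exists N.
Qed.

Lemma wt_natfloor s x : 0 <= s -> s <= 1 -> 1 <= x -> wt s (natfloor x) <= 2 * Rpower x (- s).
Proof.
move=> s0 s1 x1; have [|h1 h2] := natfloorP (x := x); first lra.
have h3 := INR_ge1 (natfloor_ge1 x1).
apply: (Rle_trans _ (Rpower (x / 2) (- s))); first by apply: Rpower_le_neg; lra.
rewrite Rpower_div; [|lra|lra]; rewrite Ropp_involutive Rmult_comm.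
apply: Rmult_le_compat_r; first by apply: Rlt_le; apply: Rpower_pos.
rewrite -[X in _ <= X](Rpower_1 2); last lra.
by apply: Rle_Rpower; lra.
Qed.

Lemma psum_wt e : 0 < e -> e <= 1 -> exists z, z <= 1 - / e /\ forall x, 1 <= x ->
  Rabs (psum (wt (1 - e)) x - Rpower x e / e - z) <= 2 * Rpower x (- (1 - e)).
Proof.
move=> e0 e1; have [z [z1 hz]] := wt_sum_bracket e0 e1; exists z; split => // x x1.
have [|h1 h2] := natfloorP (x := x); first lra.
have f1 := natfloor_ge1 x1; have h3 := INR_ge1 f1.
have [h4 h5] := hz _ f1.
have [||h6 h7] := Rpower_incr_bounds (u := INR (natfloor x)) (v := x) e0 e1; first lra.
  exact: h1.
have h8 := @wt_natfloor (1 - e) x.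
have h9 : 0 <= (x - INR (natfloor x)) * Rpower x (- (1 - e)).
  by apply: Rmult_le_pos; [lra | apply: Rlt_le; apply: Rpower_pos].
have h10 : (x - INR (natfloor x)) * Rpower (INR (natfloor x)) (- (1 - e)) <= 1 * wt (1 - e) (natfloor x).
  by apply: Rmult_le_compat_r; [apply: Rlt_le; apply: Rpower_pos | lra].
by rewrite /psum; apply: Rabs_le; lra.
Qed.

Lemma psum_wt_le e x : 0 < e -> e <= 1 -> 1 <= x -> psum (wt (1 - e)) x <= Rpower x e / e.
Proof.
move=> e0 e1 x1; have [|h1 h2] := natfloorP (x := x); first lra.
have f1 := natfloor_ge1 x1; have h3 := INR_ge1 f1.
have : Rpower (INR (natfloor x)) e / e <= Rpower x e / e.
  apply: Rmult_le_compat_r; first by apply: Rlt_le; apply: Rinv_0_lt_compat.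
  by apply: Rle_Rpower_l; lra.
suff : forall N, (0 < N)%N -> \sum_(1 <= n < N.+1) wt (1 - e) n <= Rpower (INR N) e / e.
  by move/(_ _ f1); rewrite /psum; lra.
elim=> // N IH _; case: (posnP N) => [->|N0].
  rewrite big_nat1 wt1 /= Rpower1_base /Rdiv Rmult_1_l.
  by rewrite -{1}Rinv_1; apply: Rinv_le_contravar.
rewrite sum_recr //; have := IH N0.
have hN := INR_gt0 N0; rewrite /wt; have -> : INR N.+1 = INR N + 1 by rewrite S_INR.
have [||h4 h5] := Rpower_incr_bounds (u := INR N) (v := INR N + 1) e0 e1; first lra.
  lra.
lra.
Qed.

(** An abstract real nonprincipal character. [Q] stands for the modulus, which survives only as a
    bound for sums over arbitrary intervals; this bound drives every convergence estimate. *)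
Record bchar (Q : R) (x : nat -> R) : Prop := Bchar {
  bchar_mul : forall i j, x (i * j)%N = x i * x j;
  bchar_one : x 1%N = 1;
  bchar_val : forall n, x n = -1 \/ x n = 0 \/ x n = 1;
  bchar_sum : forall M N, Rabs (\sum_(M <= n < N) x n) <= Q }.

Lemma bchar_ge1 Q x : bchar Q x -> 1 <= Q.
Proof. by case=> _ x1 _ /(_ 1%N 2%N); rewrite big_nat1 x1 Rabs_R1. Qed.

Lemma bchar_abs Q x : bchar Q x -> forall n, Rabs (x n) <= 1.
Proof. by move=> h n; apply: Rabs_le; case: (bchar_val h n) => [->|[->|->]]; lra. Qed.

Lemma bchar_weaken Q Q' x : Q <= Q' -> bchar Q x -> bchar Q' x.
Proof. by move=> h [h1 h2 h3 h4]; split=> // M N; have := h4 M N; lra. Qed.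

Lemma sum_by_parts (x g : nat -> R) M N : (M <= N)%N ->
  \sum_(M <= n < N) (x n * g n) =
  (\sum_(M <= n < N) x n) * g N +
  \sum_(M <= n < N) ((\sum_(M <= k < n.+1) x k) * (g n - g n.+1)).
Proof.
move=> /subnK <-; elim: (N - M)%N => [|k IH]; first by rewrite add0n !big_geq //; ring.
have h : (M <= k + M)%N by rewrite leq_addl.
by rewrite addSn !(sum_recr _ h) IH; ring.
Qed.

Lemma abel_bound Q (x g : nat -> R) M N :
  (forall N, Rabs (\sum_(M <= n < N) x n) <= Q) ->
  (forall n, (M <= n)%N -> g n.+1 <= g n) -> (forall n, 0 <= g n) ->
  Rabs (\sum_(M <= n < N) (x n * g n)) <= Q * g M.
Proof.
move=> hx gd g0.
have Q0 : 0 <= Q by apply: Rle_trans (Rabs_pos _) (hx 0%N).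
case: (leqP N M) => [h|/ltnW h].
  by rewrite big_geq // Rabs_R0; apply: Rmult_le_pos.
rewrite sum_by_parts //; apply: Rle_trans (Rabs_triang _ _) _.
have -> : Q * g M = Q * g N + Q * (\sum_(M <= n < N) (g n - g n.+1)).
  rewrite -Rmult_plus_distr_l; congr (_ * _).
  move: h => /subnK <-; elim: (N - M)%N => [|k IH]; first by rewrite add0n big_geq //; ring.
  by rewrite addSn sum_recr ?leq_addl //; rewrite {1}IH; ring.
apply: Rplus_le_compat.
  rewrite Rabs_mult (Rabs_pos_eq (g N)) //; apply: Rmult_le_compat_r => //.
apply: Rle_trans (sum_abs _ _ _ _) _; rewrite sum_distrr.
apply: sum_le => n /andP[hn _] _; rewrite Rabs_mult.
have hg := gd n hn; rewrite (Rabs_pos_eq (g n - g n.+1)); last by lra.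
by apply: Rmult_le_compat_r; [lra | apply: hx].
Qed.

(** * L-values on the positive real axis as limits of partial sums *)

Definition lpart (x : nat -> R) (s : R) (N : nat) : R := \sum_(1 <= n < N.+1) (x n * wt s n).

Definition Lfun (x : nat -> R) (s : R) : R := real (Lim_seq (lpart x s)).

Lemma lpart_cauchy Q x s M N : bchar Q x -> 0 <= s -> (M <= N)%N ->
  Rabs (lpart x s N - lpart x s M) <= Q * wt s M.+1.
Proof.
move=> hx s0 MN; rewrite /lpart (@sum_cat _ 1 M.+1 N.+1) //.
have -> : forall u v : R, u + v - u = v by move=> *; ring.
apply: (@abel_bound Q).
- exact: (bchar_sum hx).
- by move=> n hn; apply: wt_le => //; lia.
- by move=> n; apply: Rlt_le; apply: wt_pos.
Qed.

Lemma is_lim_lpart Q x s : bchar Q x -> 0 < s -> is_lim_seq (lpart x s) (Lfun x s).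
Proof.
move=> hx s0; apply: Lim_seq_correct'; apply/ex_lim_seq_cauchy_corr => e.
have Q1 := bchar_ge1 hx.
have eQ : 0 < e / (2 * Q) by apply: Rdiv_lt_0_compat; [apply: cond_pos | lra].
have [X [X1 hX]] := Rpower_small s0 eQ.
have key n : (natfloor X <= n)%N -> Rabs (lpart x s n - lpart x s (natfloor X)) < e / 2.
  move=> hn; apply: Rle_lt_trans (lpart_cauchy hx _ hn) _; first lra.
  have -> : pos e / 2 = Q * (e / (2 * Q)) by field; lra.
  apply: Rmult_lt_compat_l; first lra.
  apply: hX; rewrite S_INR; have := @natfloorP X; lra.
exists (natfloor X) => n m hn hm.
have h1 := key n _; have h2 := key m _.
have -> : lpart x s n - lpart x s m = (lpart x s n - lpart x s (natfloor X)) - (lpart x s m - lpart x s (natfloor X)) by ring.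
apply: Rle_lt_trans (Rabs_triang _ _) _; rewrite Rabs_Ropp.
have := h1 ltac:(lia); have := h2 ltac:(lia); lra.
Qed.

Lemma lpart_Lfun Q x s N : bchar Q x -> 0 < s -> Rabs (lpart x s N - Lfun x s) <= Q * wt s N.+1.
Proof.
move=> hx s0; have hl := is_lim_lpart hx s0.
have h : is_lim_seq (fun n => Rabs (lpart x s N - lpart x s n)) (Rabs (lpart x s N - Lfun x s)).
  apply: (is_lim_seq_abs _ (lpart x s N - Lfun x s)).
  by apply: is_lim_seq_minus' => //; apply: is_lim_seq_const.
apply: (is_lim_seq_le_loc _ (fun=> Q * wt s N.+1) _ _ _ h (is_lim_seq_const _)).
exists N => n hn; rewrite Rabs_minus_sym; apply: lpart_cauchy => //; first lra.
by lia.
Qed.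

Lemma psum_Lfun Q x s y : bchar Q x -> 0 < s -> 1 <= y ->
  Rabs (psum (fun n => x n * wt s n) y - Lfun x s) <= Q * Rpower y (- s).
Proof.
move=> hx s0 y1; have Q1 := bchar_ge1 hx.
apply: Rle_trans (lpart_Lfun (natfloor y) hx s0) _.
apply: Rmult_le_compat_l; first lra.
apply: Rpower_le_neg; [lra|lra|rewrite S_INR].
have [|] := @natfloorP y; lra.
Qed.

Lemma continuous_lpart x N s : continuous (fun s => lpart x s N) s.
Proof.
elim: N => [|N IH].
  apply: (continuous_ext (fun=> 0)); last exact: continuous_const.
  by move=> t; rewrite /lpart big_geq.
apply: (continuous_ext (fun s => lpart x s N + x N.+1 * wt s N.+1)).
  by move=> t; rewrite /lpart [RHS]sum_recr.
apply: (continuous_plus (fun s => lpart x s N)) => //.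
apply: (continuous_mult (fun=> x N.+1)); first exact: continuous_const.
apply: (ex_derive_continuous (fun t => wt t N.+1)).
by rewrite /wt /Rpower; auto_derive.
Qed.

(** The continuous partial sums converge uniformly for [t > s/2]. Continuity serves twice: to locate
    a real zero, and to identify the value at 1 of an arbitrary analytic continuation. *)
Lemma continuity_pt_Lfun Q x s : bchar Q x -> 0 < s -> continuity_pt (Lfun x) s.
Proof.
move=> hx s0; have Q1 := bchar_ge1 hx.
apply/continuity_pt_locally => e.
have [|X [X1 hX]] := @Rpower_small (s / 2) (e / (4 * Q)) ltac:(lra).
  by apply: Rdiv_lt_0_compat; [apply: cond_pos | lra].
set N := natfloor X.
have key t : s / 2 < t -> Rabs (lpart x t N - Lfun x t) < e / 4.
  move=> ht; apply: Rle_lt_trans (lpart_Lfun N hx _) _; first lra.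
  have -> : pos e / 4 = Q * (e / (4 * Q)) by field; lra.
  apply: Rmult_lt_compat_l; first lra.
  apply: Rle_lt_trans (hX (INR N.+1) _).
    by apply: Rle_Rpower; [apply: INR_ge1 | lra].
  by rewrite S_INR /N; have := @natfloorP X; lra.
have e4 : 0 < e / 4 by have := cond_pos e; lra.
have /continuity_pt_filterlim/continuity_pt_locally/(_ (mkposreal _ e4)) hc := @continuous_lpart x N s.
have s2 : 0 < s / 2 by lra.
apply: filter_imp (filter_and _ _ hc (locally_ball s (mkposreal _ s2))) => t [h1 /Rabs_lt_between' h2].
have h3 := key t ltac:(rewrite /= in h2; lra); have h4 := key s ltac:(lra).
have -> : Lfun x t - Lfun x s = (lpart x t N - lpart x s N) - (lpart x t N - Lfun x t) + (lpart x s N - Lfun x s) by ring.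
apply: Rle_lt_trans (Rabs_triang _ _) _.
have := Rabs_sub_le (lpart x t N - lpart x s N) (lpart x t N - Lfun x t).
rewrite /= in h1 *; lra.
Qed.

(** * The hyperbola method *)

(* When [a n = u n * n^(e-1)], [c] is the residue at 1 of the Dirichlet series of [u], and [A0] its
   value at [1-e]. *)
Definition asym (e : R) (a : nat -> R) (c A0 K d : R) : Prop :=
  forall x, 1 <= x -> Rabs (psum a x - c * (Rpower x e / e) - A0) <= K * Rpower x (- d).

(** In the hyperbola identity the differences of the character sums are weighted by [a] itself, so
    the asymptotics of [a] must be accompanied by a bound in absolute value. *)
Definition abs_growth (a : nat -> R) (M mu : R) : Prop :=
  forall x, 1 <= x -> psum (fun n => Rabs (a n)) x <= M * Rpower x mu.

Definition twist (s : R) (x : nat -> R) (n : nat) : R := x n * wt s n.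

Lemma twist_abs Q s x n : bchar Q x -> Rabs (twist s x n) <= wt s n.
Proof.
move=> hx; rewrite /twist Rabs_mult (Rabs_pos_eq (wt s n)); last by apply: Rlt_le; apply: wt_pos.
rewrite -[X in _ <= X]Rmult_1_l; apply: Rmult_le_compat_r; first by apply: Rlt_le; apply: wt_pos.
exact: (bchar_abs hx).
Qed.

(** With the cut at [y = sqrt X], the four bounds on [d'] are, in order, the exponents of four
    errors: the remainder of [a] summed over [n <= y], the tail of the series for [L(1)], the tail
    of the series for [L(1-e)], and the oscillation of the character sums beyond [y] against the
    absolute values of [a]. *)
Lemma asym_dconv e Q x a c A0 K d M mu d' :
  0 < e -> e <= 1 / 2 -> bchar Q x -> 0 <= d -> 0 <= K -> 0 <= mu ->
  asym e a c A0 K d -> abs_growth a M mu ->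
  d' <= (d - e) / 2 -> d' <= 1 / 2 - e -> d' <= (1 - e) / 2 -> d' <= (1 - e - mu) / 2 ->
  asym e (dconv a (twist (1 - e) x)) (c * Lfun x 1) (A0 * Lfun x (1 - e))
    (K / e + Rabs c * Q / e + Rabs A0 * Q + 2 * Q * M) d'.
Proof.
move=> e0 e2 hx d0 K0 mu0 ha hM hd1 hd2 hd3 hd4 X X1.
have Q1 := bchar_ge1 hx.
set b := twist (1 - e) x; set y := sqrt X.
have y1 : 1 <= y by rewrite -sqrt_1; apply: sqrt_le_1_alt.
have yy : y * y = X by apply: sqrt_sqrt; lra.
have X0 : 0 < X by lra.
have yfl n : (0 < n)%N -> (n < (natfloor y).+1)%N -> 1 <= INR n <= y.
  by move=> n0; rewrite ltnS => /(@leq_natfloor y n) h; split; [apply: INR_ge1 | apply: h; lra].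
have yXn n : 1 <= n <= y -> y <= X / n.
  move=> hn; apply: (Rmult_le_reg_r n); first lra.
  by rewrite /Rdiv Rmult_assoc Rinv_l; nra.
rewrite psum_hyperbola // -/y.
pose r n := psum a (X / INR n) - c * (Rpower (X / INR n) e / e) - A0.
(* The factor [(X/n)^e] of the main term turns the weight [n^(e-1)] into [n^(-1)], which produces
   [L(1)]; the constant term leaves the weight alone and produces [L(1-e)]. *)
have E1 : \sum_(1 <= n < (natfloor y).+1) (b n * psum a (X / INR n)) =
   c * (Rpower X e / e) * psum (twist 1 x) y + A0 * psum b y +
   \sum_(1 <= n < (natfloor y).+1) (b n * r n).
  rewrite /psum !sum_distrr -!sum_split; apply: eq_big_nat => n /andP[n0 _].
  rewrite /r /psum /b /twist.
  have -> : wt 1 n = wt (1 - e) n * Rpower (INR n) (- e).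
    by rewrite /wt -Rpower_plus; congr Rpower; ring.
  rewrite Rpower_div //; last exact: INR_gt0.
  by field; lra.
rewrite E1.
have [Y0 Yd] : 0 < Rpower X (- d') /\ forall s, s <= - d' -> Rpower X s <= Rpower X (- d').
  by split; [apply: Rpower_pos | move=> s hs; apply: Rle_Rpower].
have B1 : Rabs (\sum_(1 <= n < (natfloor y).+1) (b n * r n)) <= K / e * Rpower X (- d').
  apply: Rle_trans (sum_abs _ _ _ _) _.
  apply: (Rle_trans _ (\sum_(1 <= n < (natfloor y).+1) (K * Rpower X (- d) * Rpower y d * wt (1 - e) n))).
    apply: sum_le => n /andP[n0 n1] _; rewrite Rabs_mult.
    have hn := yfl _ n0 n1; have hXn := yXn _ hn.
    have h1 := twist_abs (1 - e) n hx.
    have h2 : Rabs (r n) <= K * Rpower X (- d) * Rpower y d.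
      apply: Rle_trans (ha _ _) _; first by rewrite /y in y1 *; lra.
      rewrite Rpower_div //; last lra.
      rewrite Ropp_involutive -Rmult_assoc; apply: Rmult_le_compat_l.
        by apply: Rmult_le_pos => //; apply: Rlt_le; apply: Rpower_pos.
      by apply: Rle_Rpower_l; lra.
    rewrite Rmult_comm; apply: Rmult_le_compat => //; exact: Rabs_pos.
  rewrite -sum_distrr -/(psum (wt (1 - e)) y).
  have h3 : psum (wt (1 - e)) y <= Rpower y e / e by apply: psum_wt_le; lra.
  apply: (Rle_trans _ (K * Rpower X (- d) * Rpower y d * (Rpower y e / e))).
    apply: Rmult_le_compat_l => //.
    by do 2?apply: Rmult_le_pos => //; apply: Rlt_le; apply: Rpower_pos.
  have -> : K * Rpower X (- d) * Rpower y d * (Rpower y e / e) =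
     K / e * (Rpower X (- d) * (Rpower y d * Rpower y e)) by field; lra.
  apply: Rmult_le_compat_l; first by apply: Rdiv_le_0_compat.
  rewrite /y !Rpower_sqrt_base // -!Rpower_plus; apply: Yd; lra.
have B2 : Rabs (c * (Rpower X e / e) * (psum (twist 1 x) y - Lfun x 1)) <= Rabs c * Q / e * Rpower X (- d').
  have h := psum_Lfun hx Rlt_0_1 y1.
  rewrite !Rabs_mult (Rabs_pos_eq (/ e)); last by apply: Rlt_le; apply: Rinv_0_lt_compat.
  rewrite (Rabs_pos_eq (Rpower X e)); last by apply: Rlt_le; apply: Rpower_pos.
  apply: (Rle_trans _ (Rabs c * (Rpower X e / e) * (Q * Rpower y (- (1))))).
    apply: Rmult_le_compat_l => //; apply: Rmult_le_pos; first exact: Rabs_pos.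
    by apply: Rdiv_le_0_compat => //; apply: Rlt_le; apply: Rpower_pos.
  have -> : Rabs c * (Rpower X e / e) * (Q * Rpower y (- (1))) =
    Rabs c * Q / e * (Rpower X e * Rpower y (- (1))) by field; lra.
  apply: Rmult_le_compat_l.
    by apply: Rdiv_le_0_compat => //; apply: Rmult_le_pos; [exact: Rabs_pos | lra].
  by rewrite /y Rpower_sqrt_base // -Rpower_plus; apply: Yd; lra.
have B3 : Rabs (A0 * (psum b y - Lfun x (1 - e))) <= Rabs A0 * Q * Rpower X (- d').
  have h : Rabs (psum b y - Lfun x (1 - e)) <= Q * Rpower y (- (1 - e)) by apply: psum_Lfun => //; lra.
  rewrite Rabs_mult Rmult_assoc; apply: Rmult_le_compat_l; first exact: Rabs_pos.
  apply: Rle_trans h _; apply: Rmult_le_compat_l; first lra.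
  by rewrite /y Rpower_sqrt_base //; apply: Yd; lra.
have B4 : Rabs (\sum_(1 <= m < (natfloor y).+1) (a m * (psum b (X / INR m) - psum b y)))
    <= 2 * Q * M * Rpower X (- d').
  apply: Rle_trans (sum_abs _ _ _ _) _.
  apply: (Rle_trans _ (\sum_(1 <= n < (natfloor y).+1) (2 * Q * Rpower y (- (1 - e)) * Rabs (a n)))).
    apply: sum_le => n /andP[n0 n1] _; rewrite Rabs_mult Rmult_comm.
    have hn := yfl _ n0 n1; have hXn := yXn _ hn.
    apply: Rmult_le_compat_r; first exact: Rabs_pos.
    have h1 : Rabs (psum b y - Lfun x (1 - e)) <= Q * Rpower y (- (1 - e)) by apply: psum_Lfun => //; lra.
    have h2 : Rabs (psum b (X / INR n) - Lfun x (1 - e)) <= Q * Rpower (X / INR n) (- (1 - e)).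
      by apply: psum_Lfun => //; lra.
    have h3 : Q * Rpower (X / INR n) (- (1 - e)) <= Q * Rpower y (- (1 - e)).
      by apply: Rmult_le_compat_l; [lra | apply: Rpower_le_neg; lra].
    have := Rabs_sub_le (psum b (X / INR n) - Lfun x (1 - e)) (psum b y - Lfun x (1 - e)).
    rewrite (_ : psum b (X / INR n) - Lfun x (1 - e) - (psum b y - Lfun x (1 - e)) =
      psum b (X / INR n) - psum b y); last by ring.
    lra.
  rewrite -sum_distrr -/(psum (fun n => Rabs (a n)) y).
  apply: (Rle_trans _ (2 * Q * Rpower y (- (1 - e)) * (M * Rpower y mu))).
    apply: Rmult_le_compat_l; last exact: hM.
    by apply: Rmult_le_pos; [lra | apply: Rlt_le; apply: Rpower_pos].
  have -> : 2 * Q * Rpower y (- (1 - e)) * (M * Rpower y mu) =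
    2 * Q * M * (Rpower y (- (1 - e)) * Rpower y mu) by ring.
  apply: Rmult_le_compat_l.
    have : 0 <= M.
      have := hM 1 (Rle_refl _); rewrite Rpower1_base Rmult_1_r; apply: Rle_trans.
      by apply: sum_ge0 => *; apply: Rabs_pos.
    by move=> ?; apply: Rmult_le_pos; lra.
  by rewrite /y !Rpower_sqrt_base // -!Rpower_plus; apply: Yd; lra.
set u1 := \sum_(1 <= n < (natfloor y).+1) (b n * r n) in B1 *.
set u2 := c * (Rpower X e / e) * (psum (twist 1 x) y - Lfun x 1) in B2.
set u3 := A0 * (psum b y - Lfun x (1 - e)) in B3.
set u4 := \sum_(1 <= m < (natfloor y).+1) (a m * (psum b (X / INR m) - psum b y)) in B4 *.
have -> : c * (Rpower X e / e) * psum (twist 1 x) y + A0 * psum b y + u1 + u4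
    - c * Lfun x 1 * (Rpower X e / e) - A0 * Lfun x (1 - e) = (u1 + u2) + (u3 + u4).
  by rewrite /u2 /u3; ring.
have := Rabs_triang (u1 + u2) (u3 + u4); have := Rabs_triang u1 u2; have := Rabs_triang u3 u4.
lra.
Qed.

Lemma sum_quot (b : nat -> R) N m : (0 < m)%N ->
  \sum_(1 <= n < (N %/ m).+1) b n = \sum_(1 <= n < N.+1) (if (n * m <= N)%N then b n else 0).
Proof.
move=> m0; rewrite [RHS](@sum_cat _ 1 (N %/ m).+1) //; last by rewrite ltnS leq_div.
rewrite [X in _ = _ + X]sum0 ?Rplus_0_r.
  by apply: eq_big_nat => n /andP[_]; rewrite ltnS leq_divRL // => ->.
by move=> n /andP[]; rewrite ltnNge leq_divRL // => /negbTE ->.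
Qed.

Lemma sum_dconv_swap a b N :
  \sum_(1 <= n < N.+1) dconv a b n =
  \sum_(1 <= m < N.+1) (b m * \sum_(1 <= n < (N %/ m).+1) a n).
Proof.
rewrite sum_dconv.
transitivity (\sum_(1 <= m < N.+1) \sum_(1 <= n < N.+1) (if (n * m <= N)%N then a m * b n else 0)).
  apply: eq_big_nat => m /andP[m0 _]; rewrite sum_quot // sum_distrr.
  by apply: eq_bigr => n _; case: ifP => // _; ring.
rewrite exchange_big /=; apply: eq_big_nat => m /andP[m0 _]; rewrite sum_quot // sum_distrr.
by apply: eq_bigr => n _; rewrite mulnC; case: ifP => // _; ring.
Qed.

(** The relation between [s], [mu] and [t] turns [n^(-s) (X/n)^mu] into [X^mu n^(-1-t)], summable
    over [n]. So convolution changes the constant but not the growth exponent [mu]. *)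
Lemma abs_growth_dconv Q s x a M mu t : bchar Q x -> 0 < t -> s + mu = 1 + t -> 0 <= M ->
  abs_growth a M mu -> abs_growth (dconv a (twist s x)) (M * (1 + / t)) mu.
Proof.
move=> hx t0 st M0 ha X X1; have X0 : 0 < X by lra.
apply: (Rle_trans _ (psum (dconv (fun n => Rabs (a n)) (fun n => Rabs (twist s x n))) X)).
  apply: sum_le => n _ _; apply: Rle_trans (sum_abs _ _ _ _) _.
  by apply: sum_le => d _ _; rewrite Rabs_mult; lra.
rewrite /psum sum_dconv_swap.
apply: (Rle_trans _ (\sum_(1 <= n < (natfloor X).+1) (M * Rpower X mu * Rpower (INR n) (- 1 - t)))).
  apply: sum_le => n /andP[n0 nX] _.
  have hn := INR_ge1 n0; have nX' : INR n <= X by apply/leq_natfloor; [lra|lia].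
  have Xn : 1 <= X / INR n.
    apply: (Rmult_le_reg_r (INR n)); first lra.
    by rewrite /Rdiv Rmult_assoc Rinv_l; lra.
  have -> : M * Rpower X mu * Rpower (INR n) (-1 - t) = wt s n * (M * Rpower (X / INR n) mu).
    rewrite Rpower_div //; last lra.
    rewrite (_ : -1 - t = - s + - mu) ?Rpower_plus /wt; last lra.
    by ring.
  apply: Rmult_le_compat.
  - exact: Rabs_pos.
  - by apply: sum_ge0 => *; apply: Rabs_pos.
  - exact: (twist_abs s n hx).
  - by rewrite -natfloor_div //; [apply: ha | lra].
rewrite -sum_distrr.
have -> : M * (1 + / t) * Rpower X mu = M * Rpower X mu * (1 + / t) by ring.
apply: Rmult_le_compat_l; last exact: sum_Rpower_conv.
by apply: Rmult_le_pos => //; apply: Rlt_le; apply: Rpower_pos.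
Qed.

Lemma dconv_ext a a' b b' n :
  (forall k, (0 < k)%N -> a k = a' k) -> (forall k, (0 < k)%N -> b k = b' k) ->
  (0 < n)%N -> dconv a b n = dconv a' b' n.
Proof.
move=> ha hb n0; rewrite /dconv big_nat_cond [RHS]big_nat_cond.
apply: eq_bigr => d /andP[/andP[d0 _] dn]; rewrite ha // hb //.
exact: divn_dvd_gt0.
Qed.

Lemma dconv_twist s x y n : (0 < n)%N ->
  dconv (twist s x) (twist s y) n = wt s n * dconv x y n.
Proof.
move=> n0; rewrite -dconv_mul //; last exact: wtM.
by apply: dconv_ext => // k _; rewrite /twist Rmult_comm.
Qed.

Lemma harmonic_ge_ln N : ln (INR N.+1) <= \sum_(1 <= n < N.+1) wt 1 n.
Proof.
elim: N => [|N IH]; first by rewrite big_geq //= ln_1; lra.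
rewrite sum_recr //.
have hN := INR_gt0 (ltn0Sn N).
have -> : INR N.+2 = INR N.+1 * (1 + / INR N.+1) by rewrite S_INR; field; lra.
have hi := Rinv_0_lt_compat _ hN.
rewrite ln_mult //; last lra.
have : ln (1 + / INR N.+1) <= wt 1 N.+1.
  rewrite /wt Rpower_Ropp Rpower_1 // -{2}(ln_exp (/ INR N.+1)).
  by apply: ln_le; [lra | apply: exp_ineq1_le].
lra.
Qed.

Lemma sum_squares_le (F : nat -> R) M : (forall n, (0 < n)%N -> 0 <= F n) ->
  \sum_(1 <= m < M.+1) F (m * m)%N <= \sum_(1 <= n < (M * M).+1) F n.
Proof.
move=> F0; elim: M => [|M IH]; first by rewrite !big_geq //; lra.
rewrite sum_recr // (@sum_cat _ 1 (M * M).+1 (M.+1 * M.+1).+1) //; last by nia.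
rewrite (@sum_recr _ (M * M).+1 (M.+1 * M.+1)); last by nia.
suff : 0 <= \sum_((M * M).+1 <= i < (M.+1 * M.+1)) F i by lra.
by apply: sum_ge0 => i /andP[h _] _; apply: F0; lia.
Qed.

Lemma abs_growth_wt e : 0 < e -> e <= 1 -> abs_growth (wt (1 - e)) (/ e) e.
Proof.
move=> e0 e1 x x1; rewrite Rmult_comm; apply: Rle_trans (psum_wt_le e0 e1 x1).
rewrite /psum; apply: sum_le => n _ _; rewrite Rabs_pos_eq; first lra.
by apply: Rlt_le; apply: wt_pos.
Qed.

Lemma asym_wt e : 0 < e -> e <= 1 -> exists z, z <= 1 - / e /\ asym e (wt (1 - e)) 1 z 2 (1 - e).
Proof.
move=> e0 e1; have [z [z1 hz]] := psum_wt e0 e1; exists z; split => // x x1.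
by rewrite Rmult_1_l; apply: hz.
Qed.

(* At [s = 1/2] the sum of [(1 * chi)(n) / sqrt n] is at least harmonic, which is incompatible with
   a nonpositive leading term [2 L(1) sqrt x]. *)
Lemma Lfun1_pos Q x : bchar Q x -> 0 < Lfun x 1.
Proof.
move=> hx; have Q1 := bchar_ge1 hx.
have e0 : 0 < 1 / 2 by lra.
have e1 : 1 / 2 <= 1 by lra.
have [z [_ hz]] := asym_wt e0 e1.
(* For [e = d = mu = 1/2] the largest admissible [d'] is exactly 0: the error is just bounded, which
   is enough against a divergent lower bound. *)
have hA := @asym_dconv (1 / 2) Q x _ _ _ _ _ _ _ 0 e0 (Rle_refl _) hx _ _ _ hz (abs_growth_wt e0 e1).
move: hA; set K := _ + 2 * Q * _; rewrite Rmult_1_l => hA.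
have {}hA : asym (1 / 2) (dconv (wt (1 - 1 / 2)) (twist (1 - 1 / 2) x)) (Lfun x 1) (z * Lfun x (1 - 1 / 2)) K 0.
  by apply: hA; lra.
apply: Rnot_le_lt => L0.
set B := z * Lfun x (1 - 1 / 2) + K.
(* Under [L(1) <= 0] the sum up to [M^2] stays below the constant [B], although its square indices
   alone contribute a harmonic sum up to [M]. *)
have hB M : (0 < M)%N -> ln (INR M.+1) <= B.
  move=> M0; apply: Rle_trans (harmonic_ge_ln M) _.
  apply: (Rle_trans _ (psum (dconv (wt (1 - 1 / 2)) (twist (1 - 1 / 2) x)) (INR (M * M)%N))).
    rewrite /psum natfloor_INR.
    have hn n : (0 < n)%N -> dconv (wt (1 - 1 / 2)) (twist (1 - 1 / 2) x) n = wt (1 / 2) n * dconv (fun=> 1) x n.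
      move=> n0; have hh : 1 - 1 / 2 = 1 / 2 by lra.
      rewrite hh -dconv_twist //; apply: dconv_ext => // k _; rewrite /twist; ring.
    have hp n : (0 < n)%N -> 0 <= dconv (wt (1 - 1 / 2)) (twist (1 - 1 / 2) x) n.
      move=> n0; apply: (@logder_ge0 _ (fun n => wt (1 - 1 / 2) n + twist (1 - 1 / 2) x n)) => //.
      + move=> p pp; apply: logder_dconv => //; apply: logder_mul => // i j i0 j0; first exact: wtM.
        by rewrite /twist wtM // (bchar_mul hx); ring.
      + by rewrite dconv1 /twist wt1 (bchar_one hx); lra.
      + move=> k k0; rewrite /twist.
        have := wt_pos (1 - 1 / 2) k; case: (bchar_val hx k) => [->|[->|->]]; lra.
    apply: Rle_trans (sum_squares_le _ hp); apply: sum_le => m /andP[m0 _] _.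
    have mm0 : (0 < m * m)%N by rewrite muln_gt0 m0.
    rewrite hn // wtM //.
    have -> : wt (1 / 2) m * wt (1 / 2) m = wt 1 m.
      by rewrite /wt -Rpower_plus; congr Rpower; lra.
    have hw := wt_pos 1 m.
    suff : 1 <= dconv (fun=> 1) x (m * m)%N by nra.
    apply: dconv_char_ge1 => //.
    - by move=> i j _ _; apply: (bchar_mul hx).
    - exact: (bchar_one hx).
    - exact: (bchar_val hx).
    - by move=> p _; rewrite lognM // addnn odd_double.
  have M1 : 1 <= INR (M * M)%N by apply: INR_ge1; rewrite muln_gt0 M0.
  have := hA _ M1; rewrite Ropp_0 Rpower_O; last lra.
  rewrite Rmult_1_r => /Rabs_le_between' [_ h].
  have hp := Rpower_pos (INR (M * M)%N) (1 / 2).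
  rewrite /B; set w := Rpower _ _ in h hp.
  have : Lfun x 1 * (w / (1 / 2)) <= 0 by nra.
  lra.
have := hB (natfloor (exp B)).+1 isT.
have he := exp_pos B.
have : B < ln (INR (natfloor (exp B)).+2).
  rewrite -{1}(ln_exp B); apply: ln_increasing => //.
  have [|h1 h2] := @natfloorP (exp B); first lra.
  by rewrite !S_INR; lra.
lra.
Qed.

(** * Siegel's theorem for abstract quadratic characters *)

(** The invariant of repeated hyperbola steps. One [B] dominates error, residue and value at [1-e],
    since all three enter the next error. The growth exponent 1/8 exceeds [e <= 1/16], so it is
    preserved by convolution, and is small enough to cost little in the error. *)
Definition controlled (e Q B : R) (a : nat -> R) (c A0 d M : R) : Prop :=
  exists K, asym e a c A0 K d /\ 0 <= K <= B /\ Rabs c <= B /\ Rabs A0 <= B /\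
    0 <= M /\ abs_growth a M (1 / 8).

Lemma Lfun_bound Q x s : bchar Q x -> 0 < s -> Rabs (Lfun x s) <= 2 * Q.
Proof.
move=> hx s0; have Q1 := bchar_ge1 hx.
have := psum_Lfun hx s0 (Rle_refl 1).
rewrite Rpower1_base /psum (natfloor_INR 1) big_nat1 wt1 (bchar_one hx).
have := Rabs_sub_le (1 * 1) (1 * 1 - Lfun x s).
rewrite (_ : 1 * 1 - (1 * 1 - Lfun x s) = Lfun x s); last by ring.
rewrite Rmult_1_r Rabs_R1; lra.
Qed.

(* One hyperbola step at [sqrt x] about halves the exponent [d] of the error; three steps take it
   from [1-e >= 15/16] through 3/8 and 1/8 to 1/32. *)
Lemma controlled_dconv e Q B x a c A0 d M d' :
  0 < e -> e <= 1 / 16 -> bchar Q x -> 0 <= d ->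
  controlled e Q B a c A0 d M ->
  d' <= (d - e) / 2 -> d' <= 3 / 8 ->
  controlled e Q (((2 / e + 2) * B + 2 * M) * Q) (dconv a (twist (1 - e) x))
    (c * Lfun x 1) (A0 * Lfun x (1 - e)) d' (M * (1 + / (1 / 8 - e))).
Proof.
move=> e0 e1 hx d0 [K [h1 [[K0 KB] [hc [hA [M0 hM]]]]]] hd1 hd2.
have Q1 := bchar_ge1 hx.
have ie : 0 < / e by apply: Rinv_0_lt_compat.
have it : 0 < / (1 / 8 - e) by apply: Rinv_0_lt_compat; lra.
have B0 : 0 <= B by lra.
exists (K / e + Rabs c * Q / e + Rabs A0 * Q + 2 * Q * M); split.
  (* For [mu = 1/8] and [e <= 1/16] the last three exponents are at least 7/16, 15/32 and 13/32,
     whence the cap 3/8 on [d']. *)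
  by apply: (asym_dconv (mu := 1 / 8) (d := d)) => //; lra.
have rc := Rabs_pos c; have rA := Rabs_pos A0.
have BQ : 0 <= B * Q by apply: Rmult_le_pos; lra.
have MQ : 0 <= M * Q by apply: Rmult_le_pos; lra.
have BQe : 0 <= B * Q * / e by apply: Rmult_le_pos; lra.
have cQ : 0 <= Rabs c * Q by apply: Rmult_le_pos; lra.
have cQe : 0 <= Rabs c * Q * / e by apply: Rmult_le_pos; lra.
have AQ : 0 <= Rabs A0 * Q by apply: Rmult_le_pos; lra.
have E : ((2 / e + 2) * B + 2 * M) * Q = 2 * (B * Q * / e) + 2 * (B * Q) + 2 * (M * Q).
  by rewrite /Rdiv; ring.
rewrite E /Rdiv.
have i1 : K * / e <= B * Q * / e.
  by apply: Rmult_le_compat_r; [lra | apply: (Rle_trans _ (B * 1)); [lra | apply: Rmult_le_compat_l; lra]].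
have i2 : Rabs c * Q * / e <= B * Q * / e.
  by apply: Rmult_le_compat_r; [lra | apply: Rmult_le_compat_r; lra].
have i3 : Rabs A0 * Q <= B * Q by apply: Rmult_le_compat_r; lra.
have K0e : 0 <= K * / e by apply: Rmult_le_pos; lra.
have l1 := Lfun_bound hx Rlt_0_1.
have l2 : Rabs (Lfun x (1 - e)) <= 2 * Q by apply: (Lfun_bound hx); lra.
have r1 := Rabs_pos (Lfun x 1); have r2 := Rabs_pos (Lfun x (1 - e)).
split; first lra.
split; first by rewrite Rabs_mult; apply: (Rle_trans _ (B * (2 * Q))); [apply: Rmult_le_compat; lra | lra].
split; first by rewrite Rabs_mult; apply: (Rle_trans _ (B * (2 * Q))); [apply: Rmult_le_compat; lra | lra].
split; first by apply: Rmult_le_pos; lra.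
by apply: (abs_growth_dconv hx) => //; lra.
Qed.

Lemma controlled_wt e : 0 < e -> e <= 1 / 16 -> exists z B, z < 0 /\ forall Q,
  controlled e Q B (wt (1 - e)) 1 z (1 - e) (/ e).
Proof.
move=> e0 e1; have [|z [z1 hz]] := asym_wt e0; first lra.
have he : 16 <= / e.
  by rewrite -(Rinv_inv 16); apply: Rinv_le_contravar; lra.
exists z, (2 + Rabs z); split; first lra.
move=> Q; exists 2; have := Rabs_pos z; rewrite Rabs_R1; do 4!(split; first by [|lra]).
split; first lra.
move=> x x1; apply: Rle_trans (abs_growth_wt e0 _ x1) _; first lra.
by apply: Rmult_le_compat_l; [lra | apply: Rle_Rpower; lra].
Qed.

Lemma logder_twist Q s x p : prime p -> bchar Q x -> logder p (twist s x) (twist s x).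
Proof.
move=> pp hx; apply: logder_mul => // i j i0 j0.
by rewrite /twist wtM // (bchar_mul hx); ring.
Qed.

Lemma logder_wt s p : prime p -> logder p (wt s) (wt s).
Proof. by move=> pp; apply: logder_mul => // i j; apply: wtM. Qed.

Lemma psum_ge1 a X : 1 <= X -> a 1%N = 1 -> (forall n, (0 < n)%N -> 0 <= a n) -> 1 <= psum a X.
Proof.
move=> X1 a1 a0; have h := natfloor_ge1 X1.
rewrite /psum (@sum_cat _ 1 2); [|by []|by []].
rewrite big_nat1 a1.
suff : 0 <= \sum_(2 <= n < (natfloor X).+1) a n by lra.
by apply: sum_ge0 => n /andP[hn _] _; apply: a0; lia.
Qed.

(** At [X = (2 C Q^3)^32] the error term is exactly 1/2, so the main term is at least 1/2; the
    exponent 96 is 3 times 32. *)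
Lemma lower_bound_opt lam e C Q : 0 < e -> 1 <= C -> 1 <= Q ->
  (forall X, 1 <= X -> 1 <= lam * (Rpower X e / e) + C * Q ^ 3 * Rpower X (- (1 / 32))) ->
  e / 2 * Rpower (2 * C) (- (32 * e)) * Rpower Q (- (96 * e)) <= lam.
Proof.
move=> e0 C1 Q1 h.
have Q3 : 1 <= Q ^ 3 by apply: pow_R1_Rle.
have CQ : 1 <= C * Q ^ 3 by nra.
set D := 2 * (C * Q ^ 3); have D0 : 0 < D by rewrite /D; lra.
have := h (Rpower D 32) _; rewrite !Rpower_mult.
rewrite (_ : 32 * - (1 / 32) = - (1)); last by field.
rewrite Rpower_Ropp Rpower_1 //.
have -> : C * Q ^ 3 * / D = 1 / 2 by rewrite /D; field; nra.
move=> hh; have {}hh : 1 <= lam * (Rpower D (32 * e) / e) + 1 / 2.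
  by apply: hh; apply: Rpower_ge1; rewrite /D; lra.
have hp := Rpower_pos D (32 * e).
have -> : e / 2 * Rpower (2 * C) (- (32 * e)) * Rpower Q (- (96 * e)) = e / 2 * / Rpower D (32 * e).
  rewrite Rmult_assoc; congr (_ * _).
  rewrite -Rpower_Ropp (_ : D = 2 * C * Q ^ 3); last by rewrite /D; ring.
  rewrite -(Rpower_mult_distr (2 * C)); [|lra|lra].
  congr (_ * _); rewrite -Rpower_pow; last lra.
  by rewrite Rpower_mult; congr Rpower; rewrite /=; ring.
apply: (Rmult_le_reg_r (Rpower D (32 * e))) => //.
rewrite Rmult_assoc Rinv_l; last lra.
have : lam * (Rpower D (32 * e) / e) * e = lam * Rpower D (32 * e) by field; lra.
have : (1 / 2) * e <= lam * (Rpower D (32 * e) / e) * e by apply: Rmult_le_compat_r; lra.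
lra.
Qed.

Lemma controlled_upper e Q B a c A0 d M X : controlled e Q B a c A0 d M -> A0 <= 0 -> 1 <= X ->
  psum a X <= c * (Rpower X e / e) + B * Rpower X (- d).
Proof.
move=> [K [h [[K0 KB] _]]] hA X1; have /Rabs_le_between' [_ h2] := h X X1.
have : K * Rpower X (- d) <= B * Rpower X (- d).
  by apply: Rmult_le_compat_r => //; apply: Rlt_le; apply: Rpower_pos.
lra.
Qed.

Lemma zeta_L_lower e : 0 < e -> e <= 1 / 16 -> exists2 k, 0 < k & forall Q x,
  bchar Q x -> 0 <= Lfun x (1 - e) -> k * Rpower Q (- (96 * e)) <= Lfun x 1.
Proof.
move=> e0 e1; have [z [B [z0 hB]]] := controlled_wt e0 e1.
set C := Rmax 1 ((2 / e + 2) * B + 2 * (/ e)).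
exists (e / 2 * Rpower (2 * C) (- (32 * e))).
  by apply: Rmult_lt_0_compat; [lra | apply: Rpower_pos].
move=> Q x hx hL; have Q1 := bchar_ge1 hx.
apply: lower_bound_opt => //; first exact: Rmax_l.
move=> X X1.
(* A single step would allow the exponent 3/8 and a factor [Q]; the weaker 1/32 and [Q^3] fit the
   optimization shared with the fourfold convolution. *)
have hc := @controlled_dconv e Q B x _ _ _ _ _ (1 / 32) e0 e1 hx _ (hB Q) _ _.
have {}hc := hc ltac:(lra) ltac:(lra) ltac:(lra).
have ge1 : 1 <= psum (dconv (wt (1 - e)) (twist (1 - e) x)) X.
  apply: psum_ge1 => //.
    by rewrite dconv1 /twist wt1 (bchar_one hx); ring.
  apply: (@logder_ge0 _ (fun n => wt (1 - e) n + twist (1 - e) x n)).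
  - by move=> p pp; apply: logder_dconv => //; [apply: logder_wt | apply: (logder_twist _ pp hx)].
  - by rewrite dconv1 /twist wt1 (bchar_one hx); lra.
  - move=> n n0; have := wt_pos (1 - e) n; rewrite /twist.
    case: (bchar_val hx n) => [->|[->|->]]; lra.
have up := controlled_upper hc _ X1.
have {up} := up ltac:(nra); rewrite Rmult_1_l => up.
apply: Rle_trans ge1 (Rle_trans _ _ _ up _); apply: Rplus_le_compat_l.
apply: Rmult_le_compat_r; first by apply: Rlt_le; apply: Rpower_pos.
have hC : (2 / e + 2) * B + 2 * / e <= C by apply: Rmax_r.
have C1 : 1 <= C by apply: Rmax_l.
have Q3 : Q <= Q ^ 3 by rewrite -{1}(pow_1 Q); apply: Rle_pow => //; lia.
apply: (Rle_trans _ (C * Q)); first by apply: Rmult_le_compat_r; lra.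
by apply: Rmult_le_compat_l; lra.
Qed.

(** The zero of [L(s,x)] at [1-e] kills the secondary term whatever [y] is, so [k] depends on [e]
    alone. The convolution is nonnegative because its logarithmic coefficients are [(1 + x)(1 + y)]
    times a positive weight. *)
Lemma biquadratic_lower e : 0 < e -> e <= 1 / 16 -> exists2 k, 0 < k & forall Q x y,
  bchar Q x -> bchar Q y -> bchar Q (fun n => x n * y n) -> Lfun x (1 - e) = 0 ->
  k * Rpower Q (- (96 * e)) <= Lfun x 1 * Lfun y 1 * Lfun (fun n => x n * y n) 1.
Proof.
move=> e0 e1; have [z [B [z0 hB]]] := controlled_wt e0 e1.
have ie : 0 < / e by apply: Rinv_0_lt_compat.
have it : 0 < / (1 / 8 - e) by apply: Rinv_0_lt_compat; lra.
set M1 := / e * (1 + / (1 / 8 - e)); set M2 := M1 * (1 + / (1 / 8 - e)).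
have M10 : 0 <= M1 by apply: Rmult_le_pos; lra.
have M20 : 0 <= M2 by apply: Rmult_le_pos; lra.
set B1 := (2 / e + 2) * B + 2 * (/ e).
set B2 := (2 / e + 2) * B1 + 2 * M1.
set B3 := (2 / e + 2) * B2 + 2 * M2.
have B0 : 0 <= B by have [K [_ [[]]]] := hB 1; lra.
have ie2 : 0 < 2 / e by apply: Rdiv_lt_0_compat; lra.
have B10 : 0 <= B1 by apply: Rplus_le_le_0_compat; [apply: Rmult_le_pos | ]; lra.
have B20 : 0 <= B2 by apply: Rplus_le_le_0_compat; [apply: Rmult_le_pos | ]; lra.
set C := Rmax 1 B3.
exists (e / 2 * Rpower (2 * C) (- (32 * e))).
  by apply: Rmult_lt_0_compat; [lra | apply: Rpower_pos].
move=> Q x y hx hy hxy hL; have Q1 := bchar_ge1 hx.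
apply: lower_bound_opt => //; first exact: Rmax_l.
move=> X X1.
have hc1 := @controlled_dconv e Q B x _ _ _ _ _ (3 / 8) e0 e1 hx _ (hB Q) _ _.
have {}hc1 := hc1 ltac:(lra) ltac:(lra) ltac:(lra).
have hc2 := @controlled_dconv e Q _ y _ _ _ _ _ (1 / 8) e0 e1 hy _ hc1 _ _.
have {}hc2 := hc2 ltac:(lra) ltac:(lra) ltac:(lra).
have hc3 := @controlled_dconv e Q _ _ _ _ _ _ _ (1 / 32) e0 e1 hxy _ hc2 _ _.
have {}hc3 := hc3 ltac:(lra) ltac:(lra) ltac:(lra).
have ge1 : 1 <= psum (dconv (dconv (dconv (wt (1 - e)) (twist (1 - e) x)) (twist (1 - e) y))
    (twist (1 - e) (fun n => x n * y n))) X.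
  apply: psum_ge1 => //.
    by rewrite !dconv1 /twist wt1 (bchar_one hx) (bchar_one hy); ring.
  apply: (@logder_ge0 _ (fun n => wt (1 - e) n + twist (1 - e) x n + twist (1 - e) y n +
      twist (1 - e) (fun n => x n * y n) n)).
  - move=> p pp.
    have l1 := logder_dconv pp (logder_wt (1 - e) pp) (logder_twist (1 - e) pp hx).
    have l2 := logder_dconv pp l1 (logder_twist (1 - e) pp hy).
    exact: logder_dconv pp l2 (logder_twist (1 - e) pp hxy).
  - by rewrite !dconv1 /twist wt1 (bchar_one hx) (bchar_one hy); lra.
  - move=> n n0; have := wt_pos (1 - e) n; rewrite /twist.
    by case: (bchar_val hx n) => [->|[->|->]]; case: (bchar_val hy n) => [->|[->|->]]; lra.
have up := controlled_upper hc3 _ X1.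
have {up} := up ltac:(rewrite hL; lra); rewrite Rmult_1_l => up.
apply: Rle_trans ge1 (Rle_trans _ _ _ up _); apply: Rplus_le_compat_l.
apply: Rmult_le_compat_r; first by apply: Rlt_le; apply: Rpower_pos.
have hC : B3 <= C by apply: Rmax_r.
have Q2 : Q <= Q * Q by nra.
have Q30 : 0 <= Q * Q * Q by nra.
have -> : Q ^ 3 = Q * Q * Q by ring.
apply: (Rle_trans _ (B3 * (Q * Q * Q))); last by apply: Rmult_le_compat_r.
rewrite -/B1 /B3 /B2 -/M1 -/M2 /B2.
(* Each hyperbola step contributes a factor [Q], but the growth terms [M1] and [M2] enter late and
   carry only [Q^2] and [Q]; [Q >= 1] raises both to [Q^3]. *)
have t1 : 0 <= M1 * Q * (Q * Q - Q) by apply: Rmult_le_pos; nra.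
have t2 : 0 <= M2 * Q * (Q * Q - 1) by apply: Rmult_le_pos; nra.
have t1' : 0 <= (2 / e + 2) * (M1 * Q * (Q * Q - Q)) by apply: Rmult_le_pos; lra.
nra.
Qed.

(** Cut the series at [Q]: the head is at most the sum of [n^(e-1)], hence at most [Q^e / e], and
    the tail is at most [Q / Q = 1] by partial summation. *)
Lemma Lfun1_upper e Q x : 0 < e -> e <= 1 -> bchar Q x -> Lfun x 1 <= (1 + / e) * Rpower Q e.
Proof.
move=> e0 e1 hx; have Q1 := bchar_ge1 hx.
have /Rabs_le_between' [h1 h2] := psum_Lfun hx Rlt_0_1 Q1.
have h3 : psum (fun n => x n * wt 1 n) Q <= Rpower Q e / e.
  apply: Rle_trans (psum_wt_le e0 e1 Q1); apply: sum_le => n /andP[n0 _] _.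
  apply: (Rle_trans _ (wt 1 n)).
    apply: Rle_trans (Rle_abs _) _; exact: twist_abs hx.
  by apply: Rle_Rpower; [apply: INR_ge1 | lra].
have h4 : Q * Rpower Q (- (1)) = 1 by rewrite Rpower_Ropp Rpower_1; [field|]; lra.
have h5 : 1 <= Rpower Q e by apply: Rpower_ge1; lra.
rewrite h4 in h1 h2; rewrite /Rdiv in h3; lra.
Qed.

Lemma Lfun_ext x y s : (forall n, x n = y n) -> Lfun x s = Lfun y s.
Proof.
move=> h; rewrite /Lfun; congr real; apply: Lim_seq_ext => n.
by apply: eq_bigr => k _; rewrite h.
Qed.

(** [Fam Q x] reads: [x] is an admissible character of modulus [Q]. The second hypothesis is the
    only arithmetic input: two members coincide, or their product is again nonprincipal, with the
    product of the moduli as bound. *)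
Lemma siegel (Fam : R -> (nat -> R) -> Prop) :
  (forall Q x, Fam Q x -> bchar Q x) ->
  (forall Q x Q' x', Fam Q x -> Fam Q' x' ->
     (forall n, x n = x' n) \/ bchar (Q * Q') (fun n => x n * x' n)) ->
  forall eps, 0 < eps -> exists2 k, 0 < k &
    forall Q x, Fam Q x -> k * Rpower Q (- eps) < Lfun x 1.
Proof.
move=> Fam_bchar Fam_mul eps eps0.
(* 97 is 96 from the lower bound for the product of L-values, plus 1 from the upper bound for
   [L(1, x1 x)]. *)
set e := Rmin (1 / 16) (eps / 97).
have e0 : 0 < e by apply: Rmin_glb_lt; lra.
have e16 : e <= 1 / 16 by apply: Rmin_l.
have e97 : 97 * e <= eps by have := Rmin_r (1 / 16) (eps / 97); rewrite -/e; lra.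
case: (classic (exists Q x, Fam Q x /\ Lfun x (1 - e) < 0)) => [[Q1 [x1 [F1 L1neg]]]|none].
- have hx1 := Fam_bchar _ _ F1; have q1 := bchar_ge1 hx1.
  have L1pos := Lfun1_pos hx1.
  have [||b [hb Lb]] := Ranalysis5.IVT_interv (Lfun x1) (1 - e) 1 _ _ L1neg L1pos.
  + by move=> a ha; apply: (continuity_pt_Lfun hx1); lra.
  + lra.
  have b1 : b <> 1 by move=> E; rewrite E in Lb; lra.
  (* The argument is rerun with [d] in place of [e], so that the zero sits exactly at [1-d]; as
     [d <= e], the smallness conditions persist. *)
  set d := 1 - b; have hd : 0 < d <= e by rewrite /d; lra.
  have Ld : Lfun x1 (1 - d) = 0 by rewrite (_ : 1 - d = b) // /d; ring.
  have [|k k0 hk] := @biquadratic_lower d (proj1 hd); first lra.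
  have id : 0 < / d by apply: Rinv_0_lt_compat; lra.
  have P1 := Rpower_pos Q1 (- (97 * d)).
  set W := Lfun x1 1 * (1 + / d).
  have W0 : 0 < W by apply: Rmult_lt_0_compat; lra.
  set k1 := k * Rpower Q1 (- (97 * d)) / W.
  have k10 : 0 < k1 by apply: Rdiv_lt_0_compat => //; apply: Rmult_lt_0_compat.
  (* The second entry covers the case where the character is [x1] itself; halving [m] below makes
     the inequality strict. *)
  set m := Rmin k1 (Lfun x1 1); have m0 : 0 < m by apply: Rmin_glb_lt.
  have m1 : m <= k1 by apply: Rmin_l.
  have m2 : m <= Lfun x1 1 by apply: Rmin_r.
  exists (m / 2); first lra.
  move=> Q x F; have hx := Fam_bchar _ _ F; have q := bchar_ge1 hx.
  have pw : Rpower Q (- eps) <= 1.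
    rewrite -(Rpower_O Q); last lra.
    by apply: Rle_Rpower; lra.
  have pw0 := Rpower_pos Q (- eps).
  case: (Fam_mul _ _ _ _ F1 F) => [E|hxy].
    by rewrite -(Lfun_ext 1 E); nra.
  have L2pos := Lfun1_pos hx; have L3pos := Lfun1_pos hxy.
  have qq : 1 <= Q1 * Q by nra.
  have h := hk (Q1 * Q) x1 x _ _ hxy Ld.
  have {}h := h ltac:(by apply: (bchar_weaken _ hx1); nra) ltac:(by apply: (bchar_weaken _ hx); nra).
  have h3 : Lfun (fun n => x1 n * x n) 1 <= (1 + / d) * Rpower (Q1 * Q) d.
    by apply: (Lfun1_upper _ _ hxy); lra.
  have pd := Rpower_pos (Q1 * Q) d.
  have h4 : k * Rpower (Q1 * Q) (- (96 * d)) <= W * Rpower (Q1 * Q) d * Lfun x 1.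
    apply: Rle_trans h _.
    have -> : W * Rpower (Q1 * Q) d * Lfun x 1 =
      Lfun x1 1 * Lfun x 1 * ((1 + / d) * Rpower (Q1 * Q) d) by rewrite /W; ring.
    by apply: Rmult_le_compat_l => //; apply: Rlt_le; apply: Rmult_lt_0_compat.
  have h5 : k * Rpower (Q1 * Q) (- (97 * d)) <= W * Lfun x 1.
    apply: (Rmult_le_reg_r (Rpower (Q1 * Q) d)) => //.
    rewrite Rmult_assoc -Rpower_plus (_ : - (97 * d) + d = - (96 * d)); last by ring.
    by lra.
  have h6 : k1 * Rpower Q (- (97 * d)) <= Lfun x 1.
    apply: (Rmult_le_reg_r W) => //.
    rewrite -Rpower_mult_distr in h5; [|lra|lra].
    have -> : k1 * Rpower Q (- (97 * d)) * W = k * (Rpower Q1 (- (97 * d)) * Rpower Q (- (97 * d))).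
      by rewrite /k1; field; lra.
    lra.
  have h7 : Rpower Q (- eps) <= Rpower Q (- (97 * d)) by apply: Rle_Rpower; lra.
  nra.
- have [k k0 hk] := zeta_L_lower e0 e16.
  exists (k / 2); first lra.
  move=> Q x F; have hx := Fam_bchar _ _ F; have q := bchar_ge1 hx.
  have L0 : 0 <= Lfun x (1 - e).
    by apply: Rnot_lt_le => h; apply: none; exists Q, x.
  have h := hk Q x hx L0.
  have h7 : Rpower Q (- eps) <= Rpower Q (- (96 * e)) by apply: Rle_Rpower; lra.
  have pw0 := Rpower_pos Q (- eps).
  nra.
Qed.

(** * Taylor bounds for complex powers *)

Lemma Cexp_add a b : Cexp (a + b)%C = (Cexp a * Cexp b)%C.
Proof.
case: a => a1 a2; case: b => b1 b2; rewrite /Cexp /Cmult /Cplus /=.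
by rewrite exp_plus cos_plus sin_plus; congr (_, _); ring.
Qed.

Lemma Cmod_Cexp a : Cmod (Cexp a) = exp (Re a).
Proof.
case: a => a1 a2; rewrite /Cmod /Cexp /=.
rewrite (_ : _ + _ = exp a1 ^ 2); first by rewrite sqrt_pow2 //; apply: Rlt_le; apply: exp_pos.
by have := sin2_cos2 a2; rewrite /Rsqr => h; apply: (eq_trans (y := exp a1 ^ 2 * (sin a2 * sin a2 + cos a2 * cos a2))); [ring | rewrite h; ring].
Qed.

Lemma Cmod_le_abs (a b : R) : Cmod (a, b) <= Rabs a + Rabs b.
Proof.
have ha := Rabs_pos a; have hb := Rabs_pos b.
rewrite /Cmod /= -[X in _ <= X]sqrt_pow2; last lra.
apply: sqrt_le_1_alt; rewrite -!Rsqr_pow2 /Rsqr /=.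
have : a * (a * 1) = Rabs a * Rabs a by rewrite -Rabs_mult Rabs_pos_eq; nra.
have : b * (b * 1) = Rabs b * Rabs b by rewrite -Rabs_mult Rabs_pos_eq; nra.
nra.
Qed.

Lemma Rabs_le_Cmod (a b : R) : Rabs a <= Cmod (a, b) /\ Rabs b <= Cmod (a, b).
Proof.
have h := Rmax_Cmod (a, b); rewrite /= in h.
by split; [apply: Rle_trans (Rmax_l _ _) h | apply: Rle_trans (Rmax_r _ _) h].
Qed.

Lemma exp_le a b : a <= b -> exp a <= exp b.
Proof. by case/Rle_lt_or_eq_dec => [h|->]; [apply: Rlt_le; apply: exp_increasing | lra]. Qed.

Lemma exp_sub1_le a : exp a - 1 <= a * exp a.
Proof.
have h := exp_ineq1_le (- a); have p := exp_pos a.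
have e : exp (- a) * exp a = 1 by rewrite -exp_plus Rplus_opp_l exp_0.
nra.
Qed.

Lemma exp_abs_ge a : 1 <= exp (Rabs a) /\ exp a <= exp (Rabs a).
Proof.
split; first by have := exp_ineq1_le (Rabs a); have := Rabs_pos a; lra.
by case: (Rle_lt_or_eq_dec _ _ (Rle_abs a)) => [h|<-]; [apply: Rlt_le; apply: exp_increasing | lra].
Qed.

Lemma exp_taylor1 a : Rabs (exp a - 1) <= Rabs a * exp (Rabs a).
Proof.
have [h1 h2] := exp_abs_ge a.
have h3 := exp_sub1_le a; have h4 := exp_ineq1_le a; have h5 := exp_pos a.
move: h1 h2; rewrite /Rabs; case: (Rcase_abs a); case: (Rcase_abs (exp a - 1)) => *; nra.
Qed.

Lemma exp_taylor2 a : Rabs (exp a - 1 - a) <= a ^ 2 * exp (Rabs a).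
Proof.
have h3 := exp_sub1_le a; have h4 := exp_ineq1_le a.
rewrite Rabs_pos_eq; last lra.
have h : a * (exp a - 1) <= Rabs a * Rabs (exp a - 1).
  by rewrite -Rabs_mult; apply: Rle_abs.
have := exp_taylor1 a; have := Rabs_pos a; have e : a ^ 2 = Rabs a * Rabs a.
  by rewrite -Rabs_mult Rabs_pos_eq; nra.
rewrite e; nra.
Qed.

Lemma sin_abs_le b : Rabs (sin b) <= Rabs b.
Proof.
have [c [_ h]] : exists c, Rmin 0 b <= c <= Rmax 0 b /\ sin b - sin 0 = cos c * (b - 0).
  have [||c hc] := @MVT_gen sin 0 b cos; last by exists c.
    by move=> x _; apply/is_derive_Reals; apply: derivable_pt_lim_sin.
  by move=> x _; apply: derivable_continuous_pt; exists (cos x); apply: derivable_pt_lim_sin.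
rewrite sin_0 !Rminus_0_r in h; rewrite h Rabs_mult -[X in _ <= X]Rmult_1_l.
apply: Rmult_le_compat_r; first exact: Rabs_pos.
by apply: Rabs_le; have := COS_bound c; lra.
Qed.

Lemma cos_sub1 b : 0 <= 1 - cos b <= Rabs b /\ 1 - cos b <= b ^ 2.
Proof.
have h := sin_abs_le (b / 2); have p := Rabs_pos (sin (b / 2)).
have -> : cos b = 1 - 2 * (Rabs (sin (b / 2)) * Rabs (sin (b / 2))).
  rewrite -Rabs_mult Rabs_pos_eq; last by nra.
  by rewrite {1}(_ : b = 2 * (b / 2)) ?cos_2a_sin; [ring | field].
have hb : Rabs (b / 2) = Rabs b / 2 by rewrite /Rdiv Rabs_mult (Rabs_pos_eq (/ 2)); lra.
have s1 : Rabs (sin (b / 2)) <= 1 by apply: Rabs_le; have := SIN_bound (b / 2); lra.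
rewrite hb in h; have e : b ^ 2 = Rabs b * Rabs b.
  by rewrite -Rabs_mult Rabs_pos_eq; nra.
rewrite e; split; [split|]; nra.
Qed.

Lemma sin_taylor b : Rabs (sin b - b) <= b ^ 2.
Proof.
have [c [hc h]] : exists c, Rmin 0 b <= c <= Rmax 0 b /\ sin b - sin 0 = cos c * (b - 0).
  have [||c hc] := @MVT_gen sin 0 b cos; last by exists c.
    by move=> x _; apply/is_derive_Reals; apply: derivable_pt_lim_sin.
  by move=> x _; apply: derivable_continuous_pt; exists (cos x); apply: derivable_pt_lim_sin.
rewrite sin_0 !Rminus_0_r in h; rewrite h.
have -> : cos c * b - b = - ((1 - cos c) * b) by ring.
have [[h1 h2] _] := cos_sub1 c.
have hcb : Rabs c <= Rabs b.
  move: hc; rewrite /Rmin /Rmax /Rabs; case: (Rle_dec 0 b) => ?; case: (Rcase_abs c) => ?; case: (Rcase_abs b) => ?; lra.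
have e : b ^ 2 = Rabs b * Rabs b by rewrite -Rabs_mult Rabs_pos_eq; nra.
rewrite Rabs_Ropp Rabs_mult (Rabs_pos_eq (1 - cos c)) // e.
by apply: Rmult_le_compat_r; [apply: Rabs_pos | lra].
Qed.

Lemma Cexp_taylor1 w : Cmod (Cexp w - 1)%C <= 3 * Cmod w * exp (Cmod w).
Proof.
case: w => a b; have [ha hb] := Rabs_le_Cmod a b; set m := Cmod (a, b) in ha hb *.
have -> : (Cexp (a, b) - 1)%C = ((exp a - 1) + exp a * (cos b - 1), exp a * sin b).
  by rewrite /Cexp /Cminus /Cplus /Copp /=; congr (_, _); ring.
apply: Rle_trans (Cmod_le_abs _ _) _.
have t1 := Rabs_triang (exp a - 1) (exp a * (cos b - 1)).
have t2 := exp_taylor1 a; have [t3 t4] := exp_abs_ge a.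
have t5 : exp (Rabs a) <= exp m by apply: exp_le.
have [[t6 t7] _] := cos_sub1 b; have t8 := sin_abs_le b.
have pa := Rabs_pos a; have pb := Rabs_pos b; have pe := exp_pos a.
move: t1; rewrite !Rabs_mult (Rabs_pos_eq (exp a)); last lra.
rewrite (Rabs_left1 (cos b - 1)); last lra.
have i1 : exp a * - (cos b - 1) <= exp m * m by apply: Rmult_le_compat; lra.
have i2 : exp a * Rabs (sin b) <= exp m * m by apply: Rmult_le_compat; [lra | apply: Rabs_pos | lra | lra].
have i3 : Rabs a * exp (Rabs a) <= m * exp m by apply: Rmult_le_compat; lra.
lra.
Qed.

(** Valid for all [w], as it is applied to [w = - h ln n], which is unbounded in [n] even for small
    [h]. The growth [exp (Cmod w)] is later absorbed by the decay of [n^(-z)]. *)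
Lemma Cexp_taylor2 w : Cmod (Cexp w - 1 - w)%C <= 4 * Cmod w ^ 2 * exp (Cmod w).
Proof.
case: w => a b; have [ha hb] := Rabs_le_Cmod a b; set m := Cmod (a, b) in ha hb *.
have -> : (Cexp (a, b) - 1 - (a, b))%C =
    ((exp a - 1 - a) + exp a * (cos b - 1), (exp a - 1) * sin b + (sin b - b)).
  by rewrite /Cexp /Cminus /Cplus /Copp /=; congr (_, _); ring.
apply: Rle_trans (Cmod_le_abs _ _) _.
have t1 := Rabs_triang (exp a - 1 - a) (exp a * (cos b - 1)).
have t1' := Rabs_triang ((exp a - 1) * sin b) (sin b - b).
have t2 := exp_taylor1 a; have [t3 t4] := exp_abs_ge a; have t2' := exp_taylor2 a.
have t5 : exp (Rabs a) <= exp m by apply: exp_le.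
have [[t6 _] t7] := cos_sub1 b; have t8 := sin_abs_le b; have t9 := sin_taylor b.
have pa := Rabs_pos a; have pb := Rabs_pos b; have pe := exp_pos a.
have a2 : a ^ 2 <= m ^ 2 by rewrite -!Rsqr_pow2; apply: Rsqr_le_abs_1; rewrite (Rabs_pos_eq m); lra.
have b2 : b ^ 2 <= m ^ 2 by rewrite -!Rsqr_pow2; apply: Rsqr_le_abs_1; rewrite (Rabs_pos_eq m); lra.
have a0 : 0 <= a ^ 2 by apply: pow2_ge_0.
have b0 : 0 <= b ^ 2 by apply: pow2_ge_0.
have m0 : 0 <= m ^ 2 by apply: pow2_ge_0.
move: t1 t1'; rewrite !Rabs_mult (Rabs_pos_eq (exp a)); last lra.
rewrite (Rabs_left1 (cos b - 1)); last lra.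
have i1 : exp a * - (cos b - 1) <= exp m * m ^ 2 by apply: Rmult_le_compat; lra.
have i2 : a ^ 2 * exp (Rabs a) <= m ^ 2 * exp m by apply: Rmult_le_compat; lra.
have i3 : Rabs (exp a - 1) * Rabs (sin b) <= (m * exp m) * m.
  apply: Rmult_le_compat; try exact: Rabs_pos; try lra.
  by apply: Rle_trans t2 _; apply: Rmult_le_compat; lra.
have i4 : b ^ 2 <= m ^ 2 * exp m by rewrite -(Rmult_1_r (b ^ 2)); apply: Rmult_le_compat; lra.
have e : m * exp m * m = m ^ 2 * exp m by ring.
lra.
Qed.

(** The power [n^(-z)] with [t = ln n]; the logarithm is the variable because both exponent laws are
    then additive. *)
Definition cpw (z : C) (t : R) : C := Cexp (- (z * RtoC t))%C.

Lemma cpw_addl z h t : cpw (z + h)%C t = (cpw z t * cpw h t)%C.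
Proof. by rewrite /cpw -Cexp_add; congr Cexp; ring. Qed.

Lemma cpw_addr z t u : cpw z (t + u) = (cpw z t * cpw z u)%C.
Proof. by rewrite /cpw -Cexp_add RtoC_plus; congr Cexp; ring. Qed.

Lemma Cmod_cpw z t : Cmod (cpw z t) = exp (- (Re z * t)).
Proof. by rewrite /cpw Cmod_Cexp; congr exp; case: z => a b /=; ring. Qed.

Lemma Cmod_cpw_arg z t : 0 <= t -> Cmod (- (z * RtoC t))%C = Cmod z * t.
Proof. by move=> t0; rewrite Cmod_opp Cmod_mult Cmod_R Rabs_pos_eq. Qed.

(* The factored remainder keeps a factor [d = O(1/n)] in each of its three terms. *)
Lemma cpw_diff_remainder z h l d s : 0 < s -> Re z = 4 * s -> Cmod h <= s -> 0 <= l -> 0 <= d <= 1 ->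
  Cmod ((cpw (z + h) l - cpw (z + h) (l + d)) - (cpw z l - cpw z (l + d))
    - h * (- (RtoC l * cpw z l) + RtoC (l + d) * cpw z (l + d)))%C <=
  Cmod h ^ 2 * (d * exp (- (s * l)) *
    (4 * (/ s) ^ 2 * (3 * (Cmod z + s) * exp (Cmod z + s)) + 4 * exp s + 3 * (/ s) * exp s)).
Proof.
move=> s0 hz hs l0 d0; set A := cpw z l; set B := cpw z d; set e1 := cpw h l; set e2 := cpw h d.
have -> : ((cpw (z + h) l - cpw (z + h) (l + d)) - (cpw z l - cpw z (l + d))
    - h * (- (RtoC l * cpw z l) + RtoC (l + d) * cpw z (l + d)) =
   A * ((e1 - 1 + h * RtoC l) * (1 - B * e2) + B * (1 - e2 - h * RtoC d) + - (h * RtoC l) * B * (1 - e2)))%C.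
  by rewrite !cpw_addl !cpw_addr RtoC_plus -/A -/B -/e1 -/e2; ring.
have mh := Cmod_ge_0 h; have mz := Cmod_ge_0 z.
have is0 := Rinv_0_lt_compat _ s0.
have hl : 0 <= Cmod h * l <= s * l by split; [apply: Rmult_le_pos | apply: Rmult_le_compat_r].
have hd : 0 <= Cmod h * d <= s by split; [apply: Rmult_le_pos; lra | nra].
have E1 : Cmod (e1 - 1 + h * RtoC l)%C <= 4 * (Cmod h * l) ^ 2 * exp (s * l).
  have := Cexp_taylor2 (- (h * RtoC l))%C; rewrite -/(cpw h l) -/e1 Cmod_cpw_arg //.
  have -> : (e1 - 1 - - (h * RtoC l) = e1 - 1 + h * RtoC l)%C by ring.
  move/Rle_trans; apply; apply: Rmult_le_compat_l; last by apply: exp_le; lra.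
  by have := pow2_ge_0 (Cmod h * l); lra.
have E2 : Cmod (1 - B * e2)%C <= 3 * (Cmod z + s) * exp (Cmod z + s) * d.
  have := Cexp_taylor1 (- ((z + h) * RtoC d))%C; rewrite -/(cpw (z + h) d) cpw_addl -/B -/e2 Cmod_cpw_arg; last lra.
  rewrite -(Cmod_opp (_ - _)).
  have -> : (- (B * e2 - 1) = 1 - B * e2)%C by ring.
  move/Rle_trans; apply; have t := Cmod_triangle z h; have p := Cmod_ge_0 (z + h)%C.
  have -> : 3 * (Cmod z + s) * exp (Cmod z + s) * d = (3 * ((Cmod z + s) * d)) * exp (Cmod z + s) by ring.
  apply: Rmult_le_compat.
  - by apply: Rmult_le_pos; [lra | apply: Rmult_le_pos; lra].
  - by apply: Rlt_le; apply: exp_pos.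
  - by apply: Rmult_le_compat_l; [lra | apply: Rmult_le_compat_r; lra].
  - by apply: exp_le; nra.
have E3 : Cmod (1 - e2 - h * RtoC d)%C <= 4 * (Cmod h * d) ^ 2 * exp s.
  have := Cexp_taylor2 (- (h * RtoC d))%C; rewrite -/(cpw h d) -/e2 Cmod_cpw_arg; last lra.
  rewrite -(Cmod_opp (_ - - _)).
  have -> : (- (e2 - 1 - - (h * RtoC d)) = 1 - e2 - h * RtoC d)%C by ring.
  move/Rle_trans; apply; apply: Rmult_le_compat_l; last by apply: exp_le; lra.
  by have := pow2_ge_0 (Cmod h * d); lra.
have E4 : Cmod (1 - e2)%C <= 3 * (Cmod h * d) * exp s.
  have := Cexp_taylor1 (- (h * RtoC d))%C; rewrite -/(cpw h d) -/e2 Cmod_cpw_arg; last lra.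
  rewrite -(Cmod_opp (_ - _)).
  have -> : (- (e2 - 1) = 1 - e2)%C by ring.
  move/Rle_trans; apply; apply: Rmult_le_compat_l; last by apply: exp_le; lra.
  lra.
have EB : Cmod B <= 1.
  by rewrite Cmod_cpw -exp_0; apply: exp_le; rewrite hz; nra.
(* This is the reason for [Re z = 4 s]: one factor [exp (- (s l))] is kept for convergence, and
   three pay for the Taylor factor [exp (s l)] and for the powers of [l], through
   [l <= exp (s l) / s]. *)
have EA : Cmod A = exp (- (s * l)) * (exp (- (s * l)) * exp (- (s * l)) * exp (- (s * l))).
  by rewrite Cmod_cpw hz -!exp_plus; congr exp; ring.
have EL : l <= / s * exp (s * l).
  have := exp_ineq1_le (s * l) => h1.
  have : / s * (s * l) <= / s * exp (s * l) by apply: Rmult_le_compat_l; lra.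
  by rewrite -Rmult_assoc Rinv_l; lra.
set X := exp (s * l) in E1 EL; set Y := exp (- (s * l)) in EA *.
have XY : X * Y = 1 by rewrite /X /Y -exp_plus Rplus_opp_r exp_0.
have X1 : 1 <= X by have := exp_ineq1_le (s * l); rewrite -/X; nra.
have Y0 : 0 < Y by apply: exp_pos.
have Y1 : Y <= 1 by nra.
set P := 3 * (Cmod z + s) * exp (Cmod z + s) in E2 *.
have P0 : 0 <= P by apply: Rmult_le_pos; [nra | apply: Rlt_le; apply: exp_pos].
have S0 : 0 < exp s by apply: exp_pos.
rewrite Cmod_mult EA.
set H := Cmod h in mh hs hl hd E1 E3 E4 *.
have bound : Cmod ((e1 - 1 + h * RtoC l) * (1 - B * e2) + B * (1 - e2 - h * RtoC d) + - (h * RtoC l) * B * (1 - e2))%C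
   <= 4 * (H * l) ^ 2 * X * (P * d) + 4 * (H * d) ^ 2 * exp s + (H * l) * (3 * (H * d) * exp s).
  apply: Rle_trans (Cmod_triangle _ _) _; apply: Rplus_le_compat.
    apply: Rle_trans (Cmod_triangle _ _) _; apply: Rplus_le_compat.
      by rewrite Cmod_mult; apply: Rmult_le_compat; try exact: Cmod_ge_0.
    rewrite Cmod_mult -[X in _ <= X]Rmult_1_l; apply: Rmult_le_compat => //; exact: Cmod_ge_0.
  rewrite !Cmod_mult Cmod_opp Cmod_mult Cmod_R (Rabs_pos_eq l) //.
  rewrite -/H; apply: Rmult_le_compat => //; try exact: Cmod_ge_0.
    by apply: Rmult_le_pos; [lra | exact: Cmod_ge_0].
  rewrite -[X in _ <= X]Rmult_1_r; apply: Rmult_le_compat_l => //; lra.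
apply: (Rle_trans _ (Y * (Y * Y * Y) * (4 * (H * l) ^ 2 * X * (P * d) + 4 * (H * d) ^ 2 * exp s + (H * l) * (3 * (H * d) * exp s)))).
  apply: Rmult_le_compat_l => //; apply: Rmult_le_pos; first lra.
  by do 2?apply: Rmult_le_pos; lra.
have l2 : l ^ 2 <= (/ s * X) ^ 2 by apply: pow_incr; lra.
have YY : Y * Y * Y <= 1 by nra.
have -> : Y * (Y * Y * Y) * (4 * (H * l) ^ 2 * X * (P * d) + 4 * (H * d) ^ 2 * exp s + (H * l) * (3 * (H * d) * exp s)) =
  H ^ 2 * (d * Y * (4 * l ^ 2 * (Y * Y * Y * X) * P + 4 * (Y * Y * Y * d) * exp s + 3 * (l * (Y * Y * Y)) * exp s)) by ring.
apply: Rmult_le_compat_l; first exact: pow2_ge_0.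
apply: Rmult_le_compat_l; first by apply: Rmult_le_pos; lra.
have YYX : Y * Y * Y * X = Y * Y by rewrite !Rmult_assoc (Rmult_comm Y X) XY; ring.
have YY0 : 0 <= Y * Y by nra.
apply: Rplus_le_compat; first apply: Rplus_le_compat.
- apply: Rmult_le_compat_r => //; rewrite YYX.
  have : l ^ 2 * (Y * Y) <= (/ s * X) ^ 2 * (Y * Y) by apply: Rmult_le_compat_r.
  have -> : (/ s * X) ^ 2 * (Y * Y) = (/ s) ^ 2 * ((X * Y) * (X * Y)) by ring.
  by rewrite XY; lra.
- apply: Rmult_le_compat_r; first lra.
  have : Y * Y * Y * d <= 1 * 1 by apply: Rmult_le_compat; nra.
  lra.
- apply: Rmult_le_compat_r; first lra.
  have : l * (Y * Y * Y) <= / s * X * (Y * Y * Y) by apply: Rmult_le_compat_r; nra.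
  have -> : / s * X * (Y * Y * Y) = / s * ((X * Y) * (Y * Y)) by ring.
  rewrite XY; have : Y * Y <= 1 by nra.
  nra.
Qed.

(** * Analytic continuation to the right half-plane *)

Notation C_series := (is_series (K := C_AbsRing) (V := C_NormedModule)).

(** Bounds for a term of the series summed by parts and for its derivative in [z]. With [l = ln n]
    and [d = O(1/n)] both are [O(n^(-1-s))], hence summable. *)
Lemma cpw_diff_bound z l d s : 0 < s -> Re z = 4 * s -> 0 <= l -> 0 <= d <= 1 ->
  Cmod (cpw z l - cpw z (l + d))%C <= d * exp (- (s * l)) * (3 * Cmod z * exp (Cmod z)) /\
  Cmod (- (RtoC l * cpw z l) + RtoC (l + d) * cpw z (l + d))%C <=
    d * exp (- (s * l)) * (/ s * (3 * Cmod z * exp (Cmod z)) + 1).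
Proof.
move=> s0 hz l0 d0; rewrite !cpw_addr RtoC_plus.
set A := cpw z l; set B := cpw z d.
have mz := Cmod_ge_0 z; have is0 := Rinv_0_lt_compat _ s0.
have E1 : Cmod (1 - B)%C <= d * (3 * Cmod z * exp (Cmod z)).
  have := Cexp_taylor1 (- (z * RtoC d))%C; rewrite -/(cpw z d) -/B Cmod_cpw_arg; last lra.
  rewrite -(Cmod_opp (_ - _)) (_ : (- (B - 1) = 1 - B)%C); last by ring.
  move/Rle_trans; apply.
  have -> : d * (3 * Cmod z * exp (Cmod z)) = 3 * (Cmod z * d) * exp (Cmod z) by ring.
  by apply: Rmult_le_compat_l; [nra | apply: exp_le; nra].
have EB : Cmod B <= 1 by rewrite Cmod_cpw -exp_0; apply: exp_le; rewrite hz; nra.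
set Y := exp (- (s * l)); set X := exp (s * l).
have XY : X * Y = 1 by rewrite /X /Y -exp_plus Rplus_opp_r exp_0.
have X1 : 1 <= X by have := exp_ineq1_le (s * l); rewrite -/X; nra.
have Y0 : 0 < Y by apply: exp_pos.
have Y1 : Y <= 1 by nra.
have EA : Cmod A = Y * (Y * Y * Y) by rewrite Cmod_cpw hz -!exp_plus; congr exp; ring.
have EL : l * Y <= / s.
  have h1 := exp_ineq1_le (s * l).
  have h2 : s * l * Y <= X * Y by apply: Rmult_le_compat_r; rewrite /X; lra.
  rewrite XY in h2; apply: (Rmult_le_reg_l s) => //; rewrite Rinv_r; lra.
set P := 3 * Cmod z * exp (Cmod z) in E1 *.
have P0 : 0 <= P by apply: Rmult_le_pos; [nra | apply: Rlt_le; apply: exp_pos].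
have YY : 0 <= Y * Y * Y <= Y by nra.
split.
  have -> : (A - A * B = A * (1 - B))%C by ring.
  rewrite Cmod_mult EA.
  have -> : d * Y * P = Y * 1 * (d * P) by ring.
  apply: Rmult_le_compat => //; try exact: Cmod_ge_0; first by nra.
  by apply: Rmult_le_compat_l; lra.
have -> : (- (RtoC l * A) + (RtoC l + RtoC d) * (A * B) = A * (- (RtoC l * (1 - B)) + RtoC d * B))%C by ring.
rewrite Cmod_mult EA.
have h : Cmod (- (RtoC l * (1 - B)) + RtoC d * B)%C <= l * (d * P) + d * 1.
  apply: Rle_trans (Cmod_triangle _ _) _; rewrite Cmod_opp !Cmod_mult !Cmod_R !Rabs_pos_eq //; last lra.
  by apply: Rplus_le_compat; apply: Rmult_le_compat_l => //; lra.
have dP : 0 <= d * P by apply: Rmult_le_pos; lra.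
apply: (Rle_trans _ (Y * (Y * (l * (d * P) + d * 1)))).
  rewrite Rmult_assoc; apply: Rmult_le_compat_l; first lra.
  apply: Rmult_le_compat => //; [lra | exact: Cmod_ge_0 | lra].
have -> : d * Y * (/ s * P + 1) = Y * (/ s * (d * P) + d) by ring.
apply: Rmult_le_compat_l; first lra.
have : l * Y * (d * P) <= / s * (d * P) by apply: Rmult_le_compat_r.
nra.
Qed.

Lemma C_series_bound (a : nat -> C) (b : nat -> R) B l :
  C_series a l -> (forall n, Cmod (a n) <= b n) -> (forall N, sum_n b N <= B) -> Cmod l <= B.
Proof.
move=> hl hab hb.
have h : is_lim_seq (fun N => Cmod (sum_n a N)) (Cmod l).
  exact: (filterlim_comp _ _ _ _ _ _ _ _ hl (filterlim_norm (K := C_AbsRing) (V := C_NormedModule) l)).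
apply: (is_lim_seq_le _ (fun=> B) (Cmod l) B _ h (is_lim_seq_const _)) => N.
apply: Rle_trans (hb N).
apply: Rle_trans (norm_sum_n_m (K := C_AbsRing) (V := C_NormedModule) a 0 N) _.
by apply: sum_n_m_le.
Qed.

Lemma C_series_ex (a : nat -> C) (b : nat -> R) B :
  (forall n, Cmod (a n) <= b n) -> (forall N, sum_n b N <= B) -> exists l, C_series a l.
Proof.
move=> hab hb.
have b0 n : 0 <= b n by apply: Rle_trans (Cmod_ge_0 _) (hab n).
have [l hl] : ex_series b.
  have [||l hl] := @ex_finite_lim_seq_incr (sum_n b) B.
  - by move=> n; rewrite sum_Sn /plus /=; have := b0 n.+1; lra.
  - exact: hb.
  - by exists l; exact: hl.
have := @ex_series_le C_AbsRing C_CompleteNormedModule a b hab (ex_intro _ l hl).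
by case=> v hv; exists v; exact: hv.
Qed.

Lemma sum_n_Rpower K s N : 0 < s -> 0 <= K ->
  sum_n (fun n => K * Rpower (INR n.+1) (- 1 - s)) N <= K * (1 + / s).
Proof.
move=> s0 K0.
have -> : sum_n (fun n => K * Rpower (INR n.+1) (- 1 - s)) N =
  K * \sum_(1 <= n < N.+2) Rpower (INR n) (- 1 - s).
  elim: N => [|N IH]; first by rewrite sum_O big_nat1.
  rewrite sum_Sn IH /plus [X in _ = K * X]sum_recr //=.
  by rewrite Rmult_plus_distr_l.
by apply: Rmult_le_compat_l => //; apply: sum_Rpower_conv.
Qed.

(** A second-order remainder bound, summed term by term, gives holomorphy directly, in place of a
    theorem on locally uniform limits. *)
Lemma C_is_derive_quadratic (F : C -> C) z D K r : 0 < r ->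
  (forall h, Cmod h < r -> Cmod (F (z + h) - F z - h * D)%C <= K * Cmod h ^ 2) ->
  is_derive (K := C_AbsRing) (V := C_NormedModule) F z D.
Proof.
move=> r0 hF; split; first exact: is_linear_scal_l.
move=> x hx; have <- := @is_filter_lim_locally_unique C_AbsRing (AbsRing_NormedModule C_AbsRing) z x hx.
move=> e.
have K1 : 0 < Rabs K + 1 by have := Rabs_pos K; lra.
have e1 : 0 < Rmin r (e / (Rabs K + 1)).
  by apply: Rmin_glb_lt => //; apply: Rdiv_lt_0_compat => //; apply: cond_pos.
exists (mkposreal _ e1) => y hy.
have {}hy : Cmod (y - z)%C < Rmin r (e / (Rabs K + 1)) by exact: hy.
have h1 : Cmod (y - z)%C < r by apply: Rlt_le_trans hy (Rmin_l _ _).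
have h2 : Cmod (y - z)%C < e / (Rabs K + 1) by apply: Rlt_le_trans hy (Rmin_r _ _).
have := hF _ h1; rewrite (_ : (z + (y - z) = y)%C); last by ring.
move=> h3; rewrite /norm /= /minus /plus /opp /scal /= /mult /=.
apply: Rle_trans h3 _; set m := Cmod (y - z)%C in h2 *.
have m0 : 0 <= m by apply: Cmod_ge_0.
have hK := Rle_abs K.
have h4 : m * (Rabs K + 1) <= e.
  have -> : pos e = e / (Rabs K + 1) * (Rabs K + 1) by field; lra.
  by apply: Rmult_le_compat_r; lra.
apply: (Rle_trans _ (e * m)); last by apply: Req_le.
have := Rmult_le_compat_r _ _ _ m0 h4; have := pow2_ge_0 m; nra.
Qed.

Ltac C_ring := match goal with |- @eq _ ?a ?b => change (@eq C a b) end; ring.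

Section DirichletSeries.
Variables (Q : R) (x : nat -> R).
Hypothesis hx : bchar Q x.

Definition cpart (m : nat) : R := \sum_(1 <= k < m.+1) x k.

Let ln1 (n : nat) := ln (INR n.+1).
Let gap (n : nat) := ln1 n.+1 - ln1 n.

Lemma ln1_ge0 n : 0 <= ln1 n.
Proof.
rewrite -ln_1; apply: ln_le; first lra.
exact: INR_ge1.
Qed.

Lemma gap_bound n : 0 <= gap n <= / INR n.+1 /\ gap n <= 1.
Proof.
have h := INR_ge1 (ltn0Sn n).
have i : 0 < / INR n.+1 by apply: Rinv_0_lt_compat; lra.
have i1 : / INR n.+1 <= 1 by rewrite -Rinv_1; apply: Rinv_le_contravar; lra.
have -> : gap n = ln (1 + / INR n.+1).
  rewrite /gap /ln1 -ln_div; [|apply: INR_gt0 => //|lra].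
  by congr ln; rewrite [INR n.+2]S_INR; field; lra.
have u : ln (1 + / INR n.+1) <= / INR n.+1.
  by rewrite -{2}(ln_exp (/ INR n.+1)); apply: ln_le; [lra | apply: exp_ineq1_le].
have l : 0 <= ln (1 + / INR n.+1) by rewrite -ln_1; apply: ln_le; lra.
lra.
Qed.

Lemma ln1S n : ln1 n.+1 = ln1 n + gap n. Proof. by rewrite /gap; ring. Qed.

Lemma gap_exp n s : gap n * exp (- (s * ln1 n)) <= Rpower (INR n.+1) (- 1 - s).
Proof.
have h := INR_ge1 (ltn0Sn n); have [[g0 g1] _] := gap_bound n.
have -> : Rpower (INR n.+1) (- 1 - s) = / INR n.+1 * exp (- (s * ln1 n)).
  rewrite (_ : -1 - s = - (1) + - s); last by ring.
  rewrite Rpower_plus (Rpower_Ropp _ 1) Rpower_1; last lra.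
  by congr (_ * _); rewrite /Rpower /ln1; congr exp; ring.
by apply: Rmult_le_compat_r => //; apply: Rlt_le; apply: exp_pos.
Qed.

Lemma cpart_bound n : Cmod (RtoC (cpart n)) <= Q.
Proof. by rewrite Cmod_R; apply: (bchar_sum hx). Qed.

(** Index [n] stands for the integer [n+1], because [ln1 n] is [ln (n+1)]; hence the partial sum
    [cpart n.+1]. *)
Definition abel_term (z : C) (n : nat) : C :=
  (RtoC (cpart n.+1) * (cpw z (ln1 n) - cpw z (ln1 n.+1)))%C.

Definition abel_dterm (z : C) (n : nat) : C :=
  (RtoC (cpart n.+1) * (- (RtoC (ln1 n) * cpw z (ln1 n)) + RtoC (ln1 n.+1) * cpw z (ln1 n.+1)))%C.

Definition Lcont (z : C) : C := epsilon (inhabits (RtoC 0)) (C_series (abel_term z)).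

Let Q0 : 0 <= Q. Proof. by have := bchar_ge1 hx; lra. Qed.

Lemma term_bound (c w : C) n s K : Cmod c <= Q -> 0 <= K ->
  Cmod w <= gap n * exp (- (s * ln1 n)) * K ->
  Cmod (c * w)%C <= Q * K * Rpower (INR n.+1) (- 1 - s).
Proof.
move=> hc K0 hw; rewrite Cmod_mult Rmult_assoc (Rmult_comm K).
apply: Rmult_le_compat; try exact: Cmod_ge_0; first exact: hc.
by apply: Rle_trans hw _; apply: Rmult_le_compat_r => //; apply: gap_exp.
Qed.

Lemma taylor1_ge0 z : 0 <= 3 * Cmod z * exp (Cmod z).
Proof.
by apply: Rmult_le_pos; [have := Cmod_ge_0 z; lra | apply: Rlt_le; apply: exp_pos].
Qed.

Lemma Lcont_series z : 0 < Re z -> C_series (abel_term z) (Lcont z).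
Proof.
move=> z0; apply: epsilon_spec.
set s := Re z / 4; have s0 : 0 < s by rewrite /s; lra.
apply: (C_series_ex (b := fun n => Q * (3 * Cmod z * exp (Cmod z)) * Rpower (INR n.+1) (- 1 - s))).
  move=> n; have [[g0 g1] g2] := gap_bound n.
  have [|h _] := @cpw_diff_bound z (ln1 n) (gap n) s s0 _ (ln1_ge0 n) (conj g0 g2).
    by rewrite /s; field.
  apply: term_bound; [exact: cpart_bound | exact: taylor1_ge0 | by rewrite ln1S].
by move=> N; apply: sum_n_Rpower => //; apply: Rmult_le_pos => //; apply: taylor1_ge0.
Qed.

(** The derivative is the sum of the termwise derivatives [abel_dterm]. The remainder is summed
    termwise for [Cmod h < s = Re z / 4], a disc that stays inside the half-plane. *)
Lemma Lcont_derivable z : 0 < Re z ->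
  ex_derive (K := C_AbsRing) (V := C_NormedModule) Lcont z.
Proof.
move=> z0; set s := Re z / 4; have s0 : 0 < s by rewrite /s; lra.
have zs : Re z = 4 * s by rewrite /s; field.
have is0 := Rinv_0_lt_compat _ s0.
have [D hD] : exists D, C_series (abel_dterm z) D.
  apply: (C_series_ex (b := fun n => Q * (/ s * (3 * Cmod z * exp (Cmod z)) + 1) * Rpower (INR n.+1) (- 1 - s))).
    move=> n; have [[g0 g1] g2] := gap_bound n.
    have [_ h] := @cpw_diff_bound z (ln1 n) (gap n) s s0 zs (ln1_ge0 n) (conj g0 g2).
    apply: term_bound; [exact: cpart_bound | | by rewrite ln1S].
    by have := taylor1_ge0 z; nra.
  move=> N; apply: sum_n_Rpower => //; apply: Rmult_le_pos => //.
  by have := taylor1_ge0 z; nra.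
exists D.
set K := 4 * (/ s) ^ 2 * (3 * (Cmod z + s) * exp (Cmod z + s)) + 4 * exp s + 3 * (/ s) * exp s.
have mz := Cmod_ge_0 z.
have K0 : 0 <= K.
  have e1 := exp_pos s; have e2 := exp_pos (Cmod z + s).
  have i1 : 0 <= 4 * (/ s) ^ 2 * (3 * (Cmod z + s) * exp (Cmod z + s)).
    apply: Rmult_le_pos; first by have := pow2_ge_0 (/ s); lra.
    by apply: Rmult_le_pos; lra.
  have i2 : 0 <= 3 * (/ s) * exp s by apply: Rmult_le_pos; lra.
  rewrite /K; lra.
apply: (@C_is_derive_quadratic _ _ _ (Q * K * (1 + / s)) s s0) => h hs.
have zh0 : 0 < Re (z + h)%C.
  have : Rabs (Re h) <= Cmod h by apply: re_le_Cmod.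
  move/Rabs_le_between; have -> : Re (z + h)%C = Re z + Re h by case: (z) => ? ?; case: (h).
  lra.
have S1 := Lcont_series zh0; have S2 := Lcont_series z0.
have S3 := is_series_minus _ _ _ _ (is_series_minus _ _ _ _ S1 S2) (is_series_scal h _ _ hD).
have -> : Q * K * (1 + / s) * Cmod h ^ 2 = Q * (Cmod h ^ 2 * K) * (1 + / s) by ring.
have hK0 : 0 <= Cmod h ^ 2 * K by apply: Rmult_le_pos => //; apply: pow2_ge_0.
apply: (C_series_bound (b := fun n => Q * (Cmod h ^ 2 * K) * Rpower (INR n.+1) (- 1 - s)) S3); last first.
  by move=> N; apply: sum_n_Rpower => //; apply: Rmult_le_pos.
move=> n; have [[g0 g1] g2] := gap_bound n.
have hr := @cpw_diff_remainder z h (ln1 n) (gap n) s s0 zs (Rlt_le _ _ hs) (ln1_ge0 n) (conj g0 g2).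
rewrite -!ln1S in hr.
set W := (X in Cmod X <= _) in hr.
set T := (X in Cmod X <= _).
have -> : T = (RtoC (cpart n.+1) * W)%C.
  rewrite /T /W /minus /plus /opp /scal /= /mult /= /abel_term /abel_dterm; ring.
apply: term_bound; [exact: cpart_bound | exact: hK0 |].
apply: Rle_trans hr _; apply: Req_le; rewrite /K; ring.
Qed.

Variable chi : Z -> C.
Hypothesis chi_x : forall n : nat, chi (Z.of_nat n) = RtoC (x n).

Lemma dirichlet_sum_by_parts z N :
  sum_n (dirichlet_term chi z) N =
  (sum_n (abel_term z) N + RtoC (cpart N.+1) * cpw z (ln1 N.+1))%C.
Proof.
have termE n : dirichlet_term chi z n = (RtoC (x n.+1) * cpw z (ln1 n))%C.
  by rewrite /dirichlet_term chi_x.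
elim: N => [|N IH].
  rewrite !sum_O termE /abel_term /cpart big_nat1; C_ring.
rewrite !sum_Sn IH termE /abel_term.
have -> : cpart N.+2 = cpart N.+1 + x N.+2 by rewrite /cpart sum_recr.
rewrite RtoC_plus /plus /=; C_ring.
Qed.

(** The boundary term of summation by parts is a bounded character sum times [(N+2)^(-z)], which
    tends to 0. *)
Lemma Lcont_dirichlet z : 0 < Re z -> C_series (dirichlet_term chi z) (Lcont z).
Proof.
move=> z0; rewrite /is_series.
have -> : Lcont z = plus (Lcont z) (zero : C_NormedModule) by rewrite plus_zero_r.
apply: (filterlim_ext (fun N => plus (sum_n (abel_term z) N : C_NormedModule)
    ((RtoC (cpart N.+1) * cpw z (ln1 N.+1))%C : C_NormedModule))).
  by move=> N; rewrite dirichlet_sum_by_parts.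
apply: (filterlim_comp_2 _ _ plus (Lcont_series z0) _ (filterlim_plus _ _)).
apply/filterlim_locally => e.
have Q1 : 0 < Q by have := bchar_ge1 hx; lra.
have eQ : 0 < e / Q by apply: Rdiv_lt_0_compat => //; apply: cond_pos.
have [X [X1 hX]] := Rpower_small z0 eQ.
exists (natfloor X) => n hn.
apply: C_NormedModule_mixin_compat1.
rewrite (_ : minus _ _ = (RtoC (cpart n.+1) * cpw z (ln1 n.+1))%C); last first.
  by rewrite /minus /plus /opp /zero /=; C_ring.
rewrite Cmod_mult Cmod_cpw.
have -> : pos e = Q * (e / Q) by field; lra.
apply: (Rle_lt_trans _ (Q * exp (- (Re z * ln1 n.+1)))).
  by apply: Rmult_le_compat_r; [apply: Rlt_le; apply: exp_pos | exact: cpart_bound].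
apply: Rmult_lt_compat_l => //.
have -> : exp (- (Re z * ln1 n.+1)) = Rpower (INR n.+2) (- Re z).
  by rewrite /Rpower /ln1; congr exp; ring.
apply: hX; have [|h1 h2] := @natfloorP X; first lra.
have : INR (natfloor X) <= INR n by apply: le_INR; lia.
by rewrite !S_INR; lra.
Qed.

Lemma dirichlet_sum_real s N :
  sum_n (dirichlet_term chi (RtoC s)) N = RtoC (lpart x s N.+1).
Proof.
have termE n : dirichlet_term chi (RtoC s) n = RtoC (x n.+1 * wt s n.+1).
  rewrite /dirichlet_term chi_x RtoC_mult; congr (_ * _)%C.
  rewrite /Cexp /wt /Rpower /RtoC /Cmult /Copp /=.
  have -> : - (s * 0 + 0 * ln (INR n.+1)) = 0 by ring.
  rewrite cos_0 sin_0; congr (_, _); rewrite ?Rmult_0_r ?Rmult_1_r //.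
  congr exp; ring.
elim: N => [|N IH]; first by rewrite sum_O termE /lpart big_nat1.
by rewrite sum_Sn IH termE /lpart [in RHS]sum_recr // RtoC_plus.
Qed.

Lemma C_filterlim_re_im (T : Type) (G : (T -> Prop) -> Prop) {FG : Filter G} (f : T -> C) (l : C) :
  filterlim f G (locally (l : C_NormedModule)) ->
  filterlim (fun t => Re (f t)) G (locally (Re l)) /\
  filterlim (fun t => Im (f t)) G (locally (Im l)).
Proof.
move=> /filterlim_locally h.
by split; apply/filterlim_locally => e; apply: filter_imp (h e) => t [].
Qed.

Lemma dirichlet_real_value s v : 0 < s -> C_series (dirichlet_term chi (RtoC s)) v ->
  v = RtoC (Lfun x s).
Proof.
move=> s0 hv; have [h1 h2] := C_filterlim_re_im hv.
have r1 : is_lim_seq (fun N => lpart x s N.+1) (Re v).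
  by apply: filterlim_ext h1 => N; rewrite dirichlet_sum_real.
have r2 : is_lim_seq (fun N => 0) (Im v).
  by apply: filterlim_ext h2 => N; rewrite dirichlet_sum_real.
have r3 := is_lim_seq_incr_1 (lpart x s) (Lfun x s).
have {}r3 := proj1 r3 (is_lim_lpart hx s0).
have e1 : Rbar.Finite (Re v) = Rbar.Finite (Lfun x s) by rewrite -(is_lim_seq_unique _ _ r1) (is_lim_seq_unique _ _ r3).
have e2 : Rbar.Finite (Im v) = Rbar.Finite 0 by rewrite -(is_lim_seq_unique _ _ r2) (is_lim_seq_unique _ _ (is_lim_seq_const 0)).
case: v e1 e2 {hv h1 h2 r1 r2} => a b /= [->] [->] //.
Qed.

Lemma is_L_value_unique v : is_L_value chi (RtoC 1) v -> v = RtoC (Lfun x 1).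
Proof.
move=> [U [F [_ [_ [_ [U1 [hol [ser <-]]]]]]]].
have cont := ex_derive_continuous _ _ (hol _ U1).
set s := fun n : nat => 1 + / INR n.+1.
have s1 n : 1 < s n by rewrite /s; have := Rinv_0_lt_compat _ (INR_gt0 (ltn0Sn n)); lra.
have slim : is_lim_seq s 1.
  have h : is_lim_seq (fun n => / INR n.+1) 0.
    have := is_lim_seq_inv _ p_infty (proj1 (is_lim_seq_incr_1 _ _) is_lim_seq_INR).
    exact.
  have := is_lim_seq_plus' _ _ _ _ (is_lim_seq_const 1) h.
  by rewrite Rplus_0_r.
have FE n : F (RtoC (s n)) = RtoC (Lfun x (s n)).
  by apply: dirichlet_real_value; [have := s1 n; lra | apply: ser; apply: s1].
have lim1 : filterlim (fun n => RtoC (s n)) eventually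
    (locally (T := AbsRing_UniformSpace C_AbsRing) (RtoC 1)).
  apply/(filterlim_locally (U := AbsRing_UniformSpace C_AbsRing)) => e.
  have /filterlim_locally/(_ e) := slim.
  apply: filter_imp => n hn; rewrite /ball /= /AbsRing_ball /= /abs /= /minus /plus /opp /=.
  by rewrite -RtoC_opp -RtoC_plus Cmod_R; exact: hn.
have [h1 h2] := C_filterlim_re_im (filterlim_comp _ _ _ _ _ _ _ _ lim1 cont).
have r1 : is_lim_seq (fun n => Lfun x (s n)) (Re (F (RtoC 1))).
  by apply: filterlim_ext h1 => n; rewrite FE.
have r2 : is_lim_seq (fun n => 0) (Im (F (RtoC 1))).
  by apply: filterlim_ext h2 => n; rewrite FE.
have r3 : is_lim_seq (fun n => Lfun x (s n)) (Lfun x 1).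
  apply: is_lim_seq_continuous slim; apply: (continuity_pt_Lfun hx); lra.
have e1 : Rbar.Finite (Re (F (RtoC 1))) = Rbar.Finite (Lfun x 1) by rewrite -(is_lim_seq_unique _ _ r1) (is_lim_seq_unique _ _ r3).
have e2 : Rbar.Finite (Im (F (RtoC 1))) = Rbar.Finite 0 by rewrite -(is_lim_seq_unique _ _ r2) (is_lim_seq_unique _ _ (is_lim_seq_const 0)).
by case: (F (RtoC 1)) e1 e2 => a b /= [->] [->].
Qed.

Lemma path_connected_half_plane : path_connected (fun z => 0 < Re z).
Proof.
move=> [a1 a2] [b1 b2] /= ha hb.
exists (fun t => (a1 + t * (b1 - a1), a2 + t * (b2 - a2))); split; last split; last split.
- move=> t; apply/filterlim_locally => e.
  have c1 : continuous (fun t => a1 + t * (b1 - a1)) t by apply: ex_derive_continuous; auto_derive.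
  have c2 : continuous (fun t => a2 + t * (b2 - a2)) t by apply: ex_derive_continuous; auto_derive.
  move/filterlim_locally/(_ e): c1 => c1; move/filterlim_locally/(_ e): c2 => c2.
  by apply: filter_imp (filter_and _ _ c1 c2) => u [].
- by congr (_, _); ring.
- by congr (_, _); ring.
- move=> t ht /=; have -> : a1 + t * (b1 - a1) = (1 - t) * a1 + t * b1 by ring.
  case: (Rle_lt_or_eq_dec _ _ (proj1 ht)) => [t0|<-]; last by lra.
  have : 0 <= (1 - t) * a1 by apply: Rmult_le_pos; lra.
  have : 0 < t * b1 by apply: Rmult_lt_0_compat.
  lra.
Qed.

Lemma open_half_plane : open (T := C_UniformSpace) (fun z => 0 < Re z).
Proof.
move=> z z0; exists (mkposreal _ z0) => y [/Rabs_lt_between' h _] /=.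
by rewrite /= in h; case: h; rewrite /Re; lra.
Qed.

(** The continuation to the half-plane shows that some value is admissible, so [epsilon] picks an
    admissible one, and uniqueness identifies it. *)
Lemma dirichlet_L_1 : dirichlet_L chi (RtoC 1) = RtoC (Lfun x 1).
Proof.
apply: is_L_value_unique; rewrite /dirichlet_L; apply: epsilon_spec.
exists (Lcont (RtoC 1)), (fun z => 0 < Re z), Lcont; split; first exact: open_half_plane.
split; first exact: path_connected_half_plane.
split; first by move=> z; lra.
split; first by rewrite /=; lra.
split; first by move=> z; apply: Lcont_derivable.
split; last by [].
by move=> z z1; apply: Lcont_dirichlet; lra.
Qed.

End DirichletSeries.

(** * Quadratic Dirichlet characters *)

(** A full period sums to 0 from any starting point, so whole periods can be removed until fewer
    than [q] terms, each at most 1 in size, remain. *)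
Lemma periodic_sum0_bound (x : nat -> R) q : (0 < q)%N ->
  (forall n, x (n + q)%N = x n) -> (forall n, Rabs (x n) <= 1) ->
  \sum_(0 <= n < q) x n = 0 -> forall M N, Rabs (\sum_(M <= n < N) x n) <= INR q.
Proof.
move=> q0 per x1 s0.
have sM M : \sum_(M <= n < M + q) x n = 0.
  elim: M => [|M IH]; first by rewrite add0n.
  have h : \sum_(M <= n < (M + q).+1) x n = x M by rewrite sum_recr ?leq_addr // IH per; ring.
  rewrite addSn; move: h; rewrite big_nat_recl ?leq_addr // => h.
  have -> : \sum_(M.+1 <= n < (M + q).+1) x n = \sum_(M <= i < M + q) x i.+1 by rewrite big_add1.
  by move: h => /= h; lra.
move=> M N; move: M; have [k] := ubnP N; elim: k N => // k IH N hN M.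
case: (leqP (M + q) N) => h.
  rewrite (@sum_cat _ M (M + q)%N N) ?leq_addr // sM Rplus_0_l.
  case: (leqP (M + q + q) N) => h2; last first.
    apply: Rle_trans (sum_abs _ _ _ _) _.
    apply: (Rle_trans _ (\sum_(M + q <= n < N) 1)); first by apply: sum_le.
    by rewrite sum_const // Rmult_1_r; apply: le_INR; lia.
  have -> : \sum_(M + q <= n < N) x n = \sum_(M <= n < N - q) x n.
    rewrite -{1}(subnK (leq_trans (leq_addl M q) h)) big_addn addnK.
    by apply: eq_bigr => i _; exact: per.
  by apply: IH; lia.
case: (leqP N M) => h2; first by rewrite big_geq // Rabs_R0; apply: pos_INR.
apply: Rle_trans (sum_abs _ _ _ _) _.
apply: (Rle_trans _ (\sum_(M <= n < N) 1)); first by apply: sum_le.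
by rewrite sum_const 1?ltnW // Rmult_1_r; apply: le_INR; lia.
Qed.

(* Multiplication by [a] permutes the residues, so the sum over a period equals its own opposite. *)
Lemma nonprincipal_sum0 (x : nat -> R) q a : (0 < q)%N ->
  (forall n, x (n + q)%N = x n) -> (forall i j, x (i * j)%N = x i * x j) ->
  (forall k, (q %| a * k)%N -> (q %| k)%N) -> x a = -1 ->
  \sum_(0 <= n < q) x n = 0.
Proof.
move=> q0 per xM cop xa.
have perk n k : x (n + k * q)%N = x n.
  by elim: k => [|k IH]; rewrite ?mul0n ?addn0 // mulSn (addnC q) addnA per.
have xmod n : x (n %% q)%N = x n by rewrite [in RHS](divn_eq n q) addnC perk.
have cancel i j : (i <= j)%N -> (j < q)%N -> (a * i = a * j %[mod q])%N -> i = j.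
  move=> ij jq /eqP; rewrite eq_sym eqn_mod_dvd ?leq_mul // -mulnBr => /cop h.
  by case: (posnP (j - i)%N) => [|p]; [lia | have := dvdn_leq p h; lia].
pose f (i : 'I_q) : 'I_q := Ordinal (ltn_pmod (a * i) q0).
have finj : injective f.
  move=> i j [h]; apply: val_inj => /=; have hi := ltn_ord i; have hj := ltn_ord j.
  by case: (leqP i j) => [|/ltnW] hij; [apply: cancel | symmetry; apply: cancel].
have : \sum_(0 <= n < q) x n = - \sum_(0 <= n < q) x n.
  transitivity (x a * \sum_(0 <= n < q) x n); last by rewrite xa; ring.
  rewrite sum_distrr !big_mkord (reindex_inj finj) /=.
  by apply: eq_bigr => i _; rewrite xmod xM.
lra.
Qed.

Lemma bchar_periodic (x : nat -> R) q a : (0 < q)%N ->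
  (forall n, x (n + q)%N = x n) -> (forall i j, x (i * j)%N = x i * x j) -> x 1%N = 1 ->
  (forall n, x n = -1 \/ x n = 0 \/ x n = 1) ->
  (forall k, (q %| a * k)%N -> (q %| k)%N) -> x a = -1 -> bchar (INR q) x.
Proof.
move=> q0 per xM x1 xv cop xa; split=> //; apply: periodic_sum0_bound => //.
  by move=> n; apply: Rabs_le; case: (xv n) => [->|[->|->]]; lra.
exact: nonprincipal_sum0 cop xa.
Qed.

Open Scope Z_scope.

(** * Coprimality and lifting of residue classes *)

Lemma gcd1_intro a b : (forall g, (g | a) -> (g | b) -> (g | 1)) -> Z.gcd a b = 1.
Proof.
move=> h; apply: Z.divide_1_r_nonneg; first exact: Z.gcd_nonneg.
by apply: h; [apply: Z.gcd_divide_l | apply: Z.gcd_divide_r].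
Qed.

Lemma gcd1_elim a b g : Z.gcd a b = 1 -> (g | a) -> (g | b) -> (g | 1).
Proof. by move=> <-; apply: Z.gcd_greatest. Qed.

Lemma gcd1_congr m n q : (q | m - n) -> Z.gcd n q = 1 -> Z.gcd m q = 1.
Proof.
move=> h h1; apply: gcd1_intro => g gm gq; apply: (gcd1_elim h1) => //.
have -> : n = m - (m - n) by ring.
by apply: Z.divide_sub_r => //; apply: Z.divide_trans gq h.
Qed.

Lemma gcd1_mulr n a b : Z.gcd n (a * b) = 1 <-> Z.gcd n a = 1 /\ Z.gcd n b = 1.
Proof.
split=> [h|[ha hb]].
  by split; apply: gcd1_intro => g h1 h2; apply: (gcd1_elim h) => //;
    [apply: Z.divide_mul_l | apply: Z.divide_mul_r].
apply/Zgcd_1_rel_prime; apply: rel_prime_mult; exact/Zgcd_1_rel_prime.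
Qed.

Lemma gcd1_mull m n a : Z.gcd (m * n) a = 1 <-> Z.gcd m a = 1 /\ Z.gcd n a = 1.
Proof. by rewrite Z.gcd_comm gcd1_mulr !(Z.gcd_comm a). Qed.

Lemma gcd1_dvd n q d : (d | q) -> Z.gcd n q = 1 -> Z.gcd n d = 1.
Proof. by case=> k -> /gcd1_mulr[]. Qed.

Lemma prime_divisor N : 1 < N -> exists2 p, Znumtheory.prime p & (p | N).
Proof.
move=> N1; have N0 : 0 <= N by lia.
move: N N0 N1; apply: (Z_lt_induction (fun N => 1 < N -> _)) => N IH N1.
case: (prime_dec N) => [h|/(not_prime_divide _ N1)[n [hn nN]]].
  by exists N => //; apply: Z.divide_refl.
have [||p pp pn] := IH n; [lia|lia|].
by exists p => //; apply: Z.divide_trans pn nN.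
Qed.

(** Primes are split off [N] one at a time, correcting the representative only when the current
    prime divides it. *)
Lemma coprime_lift N : 0 < N -> forall n d, Z.gcd n d = 1 ->
  exists m, (d | m - n) /\ Z.gcd m N = 1.
Proof.
move=> N1; have N0 : 0 <= N by lia.
move: N N0 N1; apply: (Z_lt_induction (fun N => 0 < N -> _)) => N IH N1 n d nd.
case: (Z.eq_dec N 1) => [->|N2].
  by exists n; split; [exists 0; ring | apply: Z.gcd_1_r].
have [|p pp [M NM]] := @prime_divisor N; first lia.
have p2 := prime_ge_2 _ pp.
have [||m [dm mM]] := IH M _ _ n d nd; [nia|nia|].
case: (Zdivide_dec p m) => pm; last first.
  exists m; split => //; rewrite NM gcd1_mulr; split => //.
  by rewrite Z.gcd_comm; apply/Zgcd_1_rel_prime; apply: prime_rel_prime.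
have nM : ~ (p | M) by move=> h; have := gcd1_elim mM pm h; move/Z.divide_1_r; lia.
have md : Z.gcd m d = 1 by apply: gcd1_congr dm nd.
have npd : ~ (p | d) by move=> h; have := gcd1_elim md pm h; move/Z.divide_1_r; lia.
(* Since [p] divides [m], it divides neither [d] nor [M], so the shift by [d M] makes the number
   prime to [p] while preserving its classes modulo [d] and [M]. *)
exists (m + d * M); split.
  have -> : m + d * M - n = (m - n) + d * M by ring.
  by apply: Z.divide_add_r => //; exists M; ring.
rewrite NM gcd1_mulr; split.
  by apply: gcd1_congr mM; exists d; ring.
rewrite Z.gcd_comm; apply/Zgcd_1_rel_prime; apply: prime_rel_prime => // h.
have : (p | d * M).
  have -> : d * M = m + d * M - m by ring.
  exact: Z.divide_sub_r.
by case/(prime_mult _ pp).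
Qed.

Lemma crt q1 q2 a b : (Z.gcd q1 q2 | b - a) -> exists m, (q1 | m - a) /\ (q2 | m - b).
Proof.
move=> [k hk]; have [u [v huv]] := Z.gcd_bezout q1 q2 _ erefl.
exists (a + u * q1 * k); split; first by exists (u * k); ring.
exists (- v * k); have -> : b = a + k * Z.gcd q1 q2 by rewrite -hk; ring.
by rewrite -huv; ring.
Qed.

(** * Induced and primitive characters *)

Lemma char_congr q chi m n : is_dirichlet_character q chi -> (q | m - n) -> chi m = chi n.
Proof.
move=> [per _] [k hk]; have -> : m = n + k * q by lia.
have pos j : 0 <= j -> forall n, chi (n + j * q) = chi n.
  move: j; apply: natlike_ind => [|j j0 IH] i; first by congr chi; ring.
  by rewrite -[RHS]IH -[RHS]per; congr chi; ring.
case: (Z_le_gt_dec 0 k) => k0; first exact: pos.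
rewrite -(pos (- k)); last lia.
by congr chi; ring.
Qed.

Lemma char_one q chi : is_dirichlet_character q chi -> chi 1 = RtoC 1.
Proof.
move=> [_ [mul nz]]; have h : chi 1 <> RtoC 0 by apply/nz; rewrite Z.gcd_1_l.
have e := mul 1 1; rewrite Z.mul_1_l in e.
have : (chi 1 * / chi 1 = chi 1 * chi 1 * / chi 1)%C by rewrite -e.
by rewrite -Cmult_assoc Cinv_r // Cmult_1_r.
Qed.

(* Two characters that agree off [q1 q2] are both induced from the gcd of their moduli: by the
   Chinese remainder theorem the common value depends only on the class modulo the gcd. *)
Lemma induced_from_gcd q1 q2 chi1 chi2 : 0 < q1 -> 0 < q2 ->
  is_dirichlet_character q1 chi1 -> is_dirichlet_character q2 chi2 ->
  (forall n, Z.gcd n (q1 * q2) = 1 -> chi1 n = chi2 n) ->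
  induced_from q2 chi2 (Z.gcd q1 q2).
Proof.
move=> q10 q20 h1 h2 agree; set d := Z.gcd q1 q2; set N := q1 * q2.
have N0 : 0 < N by rewrite /N; nia.
have dq1 : (d | q1) by apply: Z.gcd_divide_l.
have dq2 : (d | q2) by apply: Z.gcd_divide_r.
have d0 : 0 < d.
  have := Z.gcd_nonneg q1 q2; have : d <> 0 by move/Z.gcd_eq_0_l; lia.
  rewrite -/d; lia.
(* With [m] congruent to [a] modulo [q1] and to [b] modulo [q2], the chain is [chi2 b = chi2 m =
   chi1 m = chi1 a = chi2 a]. *)
have wd a b : (d | b - a) -> Z.gcd a N = 1 -> Z.gcd b N = 1 -> chi2 a = chi2 b.
  move=> ab ca cb; have [m [ma mb]] := crt ab.
  rewrite -(char_congr h2 mb) -(agree a ca) -(char_congr h1 ma); apply: agree.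
  move: ca cb => /gcd1_mulr[ca1 ca2] /gcd1_mulr[cb1 cb2].
  by apply/gcd1_mulr; split; [apply: gcd1_congr ma ca1 | apply: gcd1_congr mb cb2].
(* An [n] prime to [d] may share a factor with [q2], where [chi2] vanishes; the induced character is
   therefore read off at a representative prime to [N]. *)
pose rep n := epsilon (inhabits 0) (fun m => (d | m - n) /\ Z.gcd m N = 1).
have repP n : Z.gcd n d = 1 -> (d | rep n - n) /\ Z.gcd (rep n) N = 1.
  by move=> h; exact: (epsilon_spec (inhabits 0) (fun m => (d | m - n) /\ Z.gcd m N = 1) (coprime_lift N0 h)).
pose psi n := if Z.eq_dec (Z.gcd n d) 1 then chi2 (rep n) else RtoC 0.
have psi1 n : Z.gcd n d = 1 -> psi n = chi2 (rep n).
  by rewrite /psi; case: (Z.eq_dec (Z.gcd n d) 1).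
have psi0 n : Z.gcd n d <> 1 -> psi n = RtoC 0.
  by rewrite /psi; case: (Z.eq_dec (Z.gcd n d) 1).
split => //; split => //; exists psi; split; last first.
  move=> n nq; have nd : Z.gcd n d = 1 by apply: gcd1_dvd nq.
  (* [n] need not be prime to [q1]; lifting its class modulo [q2] to [m] prime to [N] leaves [chi2]
     unchanged and makes [wd] applicable. *)
  rewrite psi1 //; have [m [mn mN]] := coprime_lift N0 nq; have [r1 r2] := repP n nd.
  rewrite -(char_congr h2 mn); apply: wd => //.
  have -> : rep n - m = (rep n - n) - (m - n) by ring.
  by apply: Z.divide_sub_r => //; apply: Z.divide_trans mn.
split; [|split].
- move=> n; have g : Z.gcd (n + d) d = 1 <-> Z.gcd n d = 1.
    by split; apply: gcd1_congr; [exists (-1) | exists 1]; ring.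
  case: (Z.eq_dec (Z.gcd n d) 1) => c; last by rewrite !psi0 // g.
  have c' := proj2 g c; rewrite !psi1 //.
  have [r1 r2] := repP _ c; have [r3 r4] := repP _ c'; apply: wd => //.
  have -> : rep n - rep (n + d) = (rep n - n) - (rep (n + d) - (n + d)) - 1 * d by ring.
  by apply: Z.divide_sub_r; [apply: Z.divide_sub_r | exists 1].
- move=> m n; case: (Z.eq_dec (Z.gcd (m * n) d) 1) => c; last first.
    rewrite psi0 //; case: (Z.eq_dec (Z.gcd m d) 1) => cm; last by rewrite (psi0 m) //; ring.
    rewrite (psi0 n); first by ring.
    by move=> cn; apply: c; apply/gcd1_mull.
  have [cm cn] := proj1 (gcd1_mull m n d) c; rewrite !psi1 //.
  have [r1 r2] := repP _ c; have [r3 r4] := repP _ cm; have [r5 r6] := repP _ cn.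
  rewrite -(proj1 (proj2 h2)); apply: wd => //; last by apply/gcd1_mull.
  have -> : rep m * rep n - rep (m * n) =
    (rep m - m) * rep n + m * (rep n - n) - (rep (m * n) - m * n) by ring.
  apply: Z.divide_sub_r => //; apply: Z.divide_add_r.
    exact: Z.divide_mul_l.
  exact: Z.divide_mul_r.
- move=> n; case: (Z.eq_dec (Z.gcd n d) 1) => c; last by rewrite psi0.
  rewrite psi1 //; split=> // _; have [r1 r2] := repP _ c; apply/(proj2 (proj2 h2)).
  by case/gcd1_mulr: r2.
Qed.

(** Both characters are induced from the gcd of the moduli, so minimality of the conductors makes
    both moduli equal to it. Then the two agree on units and vanish elsewhere. *)
Lemma primitive_agree q1 q2 chi1 chi2 : 0 < q1 -> 0 < q2 ->
  is_dirichlet_character q1 chi1 -> is_dirichlet_character q2 chi2 ->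
  primitive q1 chi1 -> primitive q2 chi2 ->
  (forall n, Z.gcd n (q1 * q2) = 1 -> chi1 n = chi2 n) -> forall n, chi1 n = chi2 n.
Proof.
move=> q10 q20 h1 h2 [_ p1] [_ p2] agree.
have i2 := p2 _ (induced_from_gcd q10 q20 h1 h2 agree).
have i1 : q1 <= Z.gcd q2 q1.
  apply: p1; apply: induced_from_gcd h2 h1 _ => // n; rewrite Z.mul_comm => h.
  by rewrite agree.
have g1 := Z.divide_pos_le _ _ q10 (Z.gcd_divide_l q1 q2).
have g2 := Z.divide_pos_le _ _ q20 (Z.gcd_divide_r q1 q2).
rewrite Z.gcd_comm in i1; have E : q2 = q1 by lia.
move=> n; rewrite E in agree h2.
case: (Z.eq_dec (Z.gcd n q1) 1) => c; first by apply: agree; apply/gcd1_mulr.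
have z chi : is_dirichlet_character q1 chi -> chi n = RtoC 0.
  by move=> [_ [_ nz]]; apply: NNPP => /nz.
by rewrite (z _ h1) (z _ h2).
Qed.

(** * Quadratic characters as abstract real characters *)

Lemma quadratic_value q chi n : is_dirichlet_character q chi -> quadratic q chi ->
  chi n = RtoC (-1) \/ chi n = RtoC 0 \/ chi n = RtoC 1.
Proof.
move=> [_ [_ nz]] [_ [sq _]]; have := sq n; rewrite /principal_character.
case: (Z.eq_dec (Z.gcd n q) 1) => c; last by move=> _; right; left; apply: NNPP => /nz.
rewrite /= Cmult_1_r => h.
case: (classic (chi n = RtoC 1)) => h1; first by right; right.
case: (classic (chi n = RtoC (-1))) => h2; first by left.
have : (chi n - RtoC 1)%C <> RtoC 0.
  by move=> e; apply: h1; have -> : chi n = (chi n - RtoC 1 + RtoC 1)%C by [ring]; rewrite e; ring.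
have h3 : (chi n - RtoC (-1))%C <> RtoC 0.
  by move=> e; apply: h2; have -> : chi n = (chi n - RtoC (-1) + RtoC (-1))%C by [ring]; rewrite e; ring.
move/Cmult_neq_0 => /(_ _ h3) []; rewrite -[RHS](_ : (chi n * chi n - RtoC 1)%C = RtoC 0).
  by rewrite (_ : RtoC (-1) = - RtoC 1)%C ?RtoC_opp //; ring.
by rewrite h; ring.
Qed.

Lemma quadratic_nonprincipal q chi : 0 < q -> is_dirichlet_character q chi -> quadratic q chi ->
  exists n, Z.gcd n q = 1 /\ chi n = RtoC (-1).
Proof.
move=> q0 hc hq; have [_ [sq nonp]] := hq; apply: NNPP => none.
apply: (nonp 1%N); first lia.
move=> n; rewrite /= Cmult_1_r /principal_character.
case: (Z.eq_dec (Z.gcd n q) 1) => c; last by apply: NNPP => /(proj2 (proj2 hc)).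
have nz := proj2 (proj2 (proj2 hc) n) c.
by case: (quadratic_value n hc hq) => [h|[h|//]]; [case: none; exists n | case: nz].
Qed.

Definition char_nat (chi : Z -> C) (n : nat) : R := Re (chi (Z.of_nat n)).

Lemma char_natE q chi n : is_dirichlet_character q chi -> quadratic q chi ->
  chi (Z.of_nat n) = RtoC (char_nat chi n).
Proof.
move=> hc hq; rewrite /char_nat.
by case: (quadratic_value (Z.of_nat n) hc hq) => [->|[->|->]].
Qed.

Lemma gauss_nat (q : nat) a : Z.gcd a (Z.of_nat q) = 1 -> 0 <= a ->
  forall k, (q %| Z.to_nat a * k)%N -> (q %| k)%N.
Proof.
move=> c a0 k /dvdnP[j hj].
have : (Z.of_nat q | a * Z.of_nat k).
  exists (Z.of_nat j); rewrite -(Z2Nat.id a) // -!Nat2Z.inj_mul; congr Z.of_nat; exact: hj.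
move/Z.gauss; rewrite Z.gcd_comm => /(_ c) [i hi].
case: (posnP k) => [->|k0]; first exact: dvdn0.
apply/dvdnP; exists (Z.to_nat i); apply: Nat2Z.inj.
by rewrite hi -multE Nat2Z.inj_mul Z2Nat.id //; nia.
Qed.

(** Stated through the properties themselves so that it covers both one character and a product
    [chi1 chi2] modulo [q1 q2]. The value -1 at a unit expresses nonprincipality. *)
Lemma bchar_quadratic q (chi : Z -> C) (x : nat -> R) : 0 < q ->
  (forall m n, (q | m - n) -> chi m = chi n) ->
  (forall m n, chi (m * n) = (chi m * chi n)%C) -> chi 1 = RtoC 1 ->
  (forall n, chi n = RtoC (-1) \/ chi n = RtoC 0 \/ chi n = RtoC 1) ->
  (exists n, Z.gcd n q = 1 /\ chi n = RtoC (-1)) ->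
  (forall n, chi (Z.of_nat n) = RtoC (x n)) -> bchar (IZR q) x.
Proof.
move=> q0 per mul one val [a0 [ca ha]] hx.
have qE : q = Z.of_nat (Z.to_nat q) by rewrite Z2Nat.id //; lia.
have -> : IZR q = INR (Z.to_nat q) by rewrite INR_IZR_INZ -qE.
(* The witness is reduced modulo [q] to become a natural number, as the sum over a period is taken
   over naturals. *)
set a := a0 mod q; have a_ge : 0 <= a by have := Z.mod_pos_bound a0 q q0; rewrite -/a; lia.
have da : (q | a - a0).
  by exists (- (a0 / q)); rewrite /a; have := Z.div_mod a0 q; lia.
have xE n : x n = Re (chi (Z.of_nat n)) by rewrite hx.
apply: (bchar_periodic (a := Z.to_nat a)).
- by apply/ltP; lia.
- move=> n; rewrite !xE (per _ (Z.of_nat n)) // -plusE Nat2Z.inj_add -qE; exists 1; ring.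
- move=> i j; rewrite xE -multE Nat2Z.inj_mul mul !hx /=; ring.
- by rewrite xE one.
- move=> n; rewrite xE; case: (val (Z.of_nat n)) => [->|[->|->]] /=; auto.
- by apply: gauss_nat => //; rewrite -qE; apply: gcd1_congr ca.
- by rewrite xE Z2Nat.id // (per _ _ da) ha.
Qed.

Lemma bchar_char_nat q chi : 0 < q -> is_dirichlet_character q chi -> quadratic q chi ->
  bchar (IZR q) (char_nat chi).
Proof.
move=> q0 hc hq; apply: (@bchar_quadratic q chi) => //.
- by move=> m n; apply: char_congr hc.
- exact: (proj1 (proj2 hc)).
- exact: char_one hc.
- by move=> n; apply: quadratic_value hc hq.
- exact: quadratic_nonprincipal.
- by move=> n; apply: char_natE hc hq.
Qed.

(** At a unit modulo [q1 q2] where the characters differ, one value is 1 and the other -1, so the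
    product takes the value -1. If there is no such unit, primitivity makes the characters equal. *)
Lemma bchar_product q1 q2 chi1 chi2 : 0 < q1 -> 0 < q2 ->
  is_dirichlet_character q1 chi1 -> is_dirichlet_character q2 chi2 ->
  primitive q1 chi1 -> primitive q2 chi2 -> quadratic q1 chi1 -> quadratic q2 chi2 ->
  (forall n, char_nat chi1 n = char_nat chi2 n) \/
  bchar (IZR q1 * IZR q2) (fun n => char_nat chi1 n * char_nat chi2 n)%R.
Proof.
move=> q10 q20 h1 h2 p1 p2 c1 c2.
case: (classic (forall n, Z.gcd n (q1 * q2) = 1 -> chi1 n = chi2 n)) => [agree|].
  by left=> n; rewrite /char_nat (primitive_agree q10 q20 h1 h2 p1 p2 agree).
move=> /not_all_ex_not[a na0]; have {na0}[ca na] := imply_to_and _ _ na0; right.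
rewrite -mult_IZR; apply: (@bchar_quadratic _ (fun n => chi1 n * chi2 n)%C); first nia.
- move=> m n hmn; rewrite (char_congr h1 (m := m) (n := n)) ?(char_congr h2 (m := m) (n := n)) //.
    by apply: Z.divide_trans hmn; exists q1.
  by apply: Z.divide_trans hmn; exists q2; ring.
- by move=> m n; rewrite (proj1 (proj2 h1)) (proj1 (proj2 h2)); ring.
- by rewrite (char_one h1) (char_one h2) -RtoC_mult Rmult_1_l.
- move=> n; case: (quadratic_value n h1 c1) => [->|[->|->]];
    case: (quadratic_value n h2 c2) => [->|[->|->]]; rewrite -RtoC_mult ?Rmult_0_l ?Rmult_0_r ?Rmult_1_l ?Rmult_1_r; auto.
  by right; right; congr RtoC; ring.
- exists a; split => //; case/gcd1_mulr: ca => ca1 ca2.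
  have n1 := proj2 (proj2 (proj2 h1) a) ca1; have n2 := proj2 (proj2 (proj2 h2) a) ca2.
  move: n1 n2 na.
  case: (quadratic_value a h1 c1) => [->|[->|->]]; case: (quadratic_value a h2 c2) => [->|[->|->]] // _ _ _;
    by rewrite -RtoC_mult; congr RtoC; ring.
- move=> n; rewrite (char_natE n h1 c1) (char_natE n h2 c2) RtoC_mult //.
Qed.

Open Scope R_scope.

Theorem theorem1 :
  forall eps : R, 0 < eps ->
  exists c : R, 0 < c /\
    forall (q : Z) (chi : Z -> C),
      (0 < q)%Z ->
      is_dirichlet_character q chi ->
      primitive q chi ->
      quadratic q chi ->
      Im (dirichlet_L chi (RtoC 1)) = 0 /\
      Re (dirichlet_L chi (RtoC 1)) > c * Rpower (IZR q) (- eps).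
Proof.
move=> eps eps0.
pose Fam Q x := exists q chi, [/\ (0 < q)%Z, is_dirichlet_character q chi, primitive q chi &
  quadratic q chi] /\ Q = IZR q /\ x = char_nat chi.
have [||c c0 hc] := @siegel Fam _ _ eps eps0.
- by move=> Q x [q [chi [[q0 hc hp hq] [-> ->]]]]; apply: bchar_char_nat.
- move=> Q x Q' x' [q [chi [[q0 hc hp hq] [-> ->]]]] [q' [chi' [[q0' hc' hp' hq'] [-> ->]]]].
  exact: bchar_product.
exists c; split => // q chi q0 hchi hp hq.
rewrite (@dirichlet_L_1 (IZR q) (char_nat chi)) /=.
- by split => //; apply: hc; exists q, chi.
- exact: bchar_char_nat.
- by move=> n; apply: char_natE hchi hq.
Qed.
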